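(* For every integer $n\ge1$: $|\mathcal D(\delta_{n+2}/\delta_n)|=s_n$ and $|\mathcal D(\delta_{n+4}/\delta_n)|=\tfrac12\big(s_ns_{n+2}-s_{n+1}^2\big)$. More generally, for all $k\ge1$, $$|\mathcal D(\delta_{n+2k}/\delta_n)|=2^{-\binom{k}{2}}\det\big[s_{n-2+i+j}\big]_{i,j=1}^k.$$
   Context: $\delta_m$ denotes the staircase partition $(m-1,m-2,\dots,1)$, identified with its Young diagram $\{(i,j):1\le j\le m-i\}$ (English convention). $s_m$ is the $m$-th little Schröder number: the number of lattice paths from $(0,0)$ to $(m,m)$ with steps $(1,0),(0,1),(1,1)$ that never go below the diagonal $x=y$ and have no $(1,1)$ step on that diagonal ($s_1=1,s_2=3,s_3=11,\dots$). Generalized excited diagrams: for a set $S$ of cells of a Young diagram $\lambda$, a cell $(i,j)\in S$ is active if $(i+1,j),(i,j+1),(i+1,j+1)\in\lambda\setminus S$; for active $(i,j)$ the type I move replaces $(i,j)$ by $(i+1,j+1)$ and the type II move adds $(i+1,j+1)$ to $S$. For $\mu\subseteq\lambda$, $\mathcal D(\lambda/\mu)$ is the set of subsets of $\lambda$ obtainable from the diagram of $\mu$ by sequences of type I and II moves. *)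

(* Defs.v *)
From HB Require Import structures.
From mathcomp Require Import all_boot all_order all_algebra.
Set Implicit Arguments. Unset Strict Implicit. Unset Printing Implicit Defensive.
Import Order.TTheory GRing.Theory Num.Theory.

(* Cells are pairs (i,j) of naturals (row i, column j, English convention,
   1-indexed).  The staircase delta_m = (m-1,...,1) has cells
   {(i,j) : 1 <= i, 1 <= j <= m - i}. *)
Definition in_delta (m : nat) (c : nat * nat) : bool :=
  [&& 0 < c.1, 0 < c.2 & c.2 <= m - c.1].

(* Ambient finite type of candidate cells; all cells of delta_m have both
   coordinates < m, so 'I_N * 'I_N with N = m suffices. *)
Definition cellT (N : nat) := ('I_N * 'I_N)%type.

Definition ncell N (c : cellT N) : nat * nat := (nat_of_ord c.1, nat_of_ord c.2).

Definition memN N (S : {set cellT N}) (a : nat * nat) : bool :=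
  [exists c in S, ncell c == a].

Definition diagram N (sh : pred (nat * nat)) : {set cellT N} :=
  [set c : cellT N | sh (ncell c)].

Definition freeN N (lam : pred (nat * nat)) (S : {set cellT N}) a : bool :=
  lam a && ~~ memN S a.

Definition active N (lam : pred (nat * nat)) (S : {set cellT N}) (c : cellT N) :=
  let: (i, j) := ncell c in
  [&& c \in S, freeN lam S (i.+1, j), freeN lam S (i, j.+1)
   & freeN lam S (i.+1, j.+1)].

Definition gex_step N (lam : pred (nat * nat)) (S S' : {set cellT N}) : bool :=
  [exists c : cellT N, active lam S c &&
    [exists c' : cellT N,
       (ncell c' == ((ncell c).1.+1, (ncell c).2.+1)) &&
       ((S' == c' |: (S :\ c))
        || (S' == c' |: S))]].

Definition gen_excited N (lam mu : pred (nat * nat)) : {set {set cellT N}} :=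
  [set S | connect (gex_step lam) (diagram N mu) S].

Definition nGED (m n : nat) : nat :=
  #|gen_excited m (in_delta m) (in_delta n)|.

(* Little Schroeder numbers via lattice paths.  Steps coded in 'I_3:
   0 = (1,0), 1 = (0,1), 2 = (1,1).  A path from (x,y) is valid if it ends at
   (m,m), stays weakly above the diagonal (x <= y at every point), and has no
   (1,1) step starting on the diagonal. *)
Fixpoint schroeder_ok (m x y : nat) (w : seq 'I_3) : bool :=
  match w with
  | [::] => (x == m) && (y == m)
  | s :: w' =>
      let x' := if (val s == 0) || (val s == 2) then x.+1 else x in
      let y' := if (val s == 1) || (val s == 2) then y.+1 else y in
      [&& x' <= y', (val s == 2) ==> (x != y) & schroeder_ok m x' y' w']
  end.

(* every such path has length <= 2m, so we count words of length <= 2m *)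
Definition little_schroeder (m : nat) : nat :=
  \sum_(l < (2 * m).+1) #|[set t : l.-tuple 'I_3 | schroeder_ok m 0 0 t]|.

(* Main.v *)
Require Import Defs.
From HB Require Import structures.
From mathcomp Require Import all_boot all_order all_algebra.
From mathcomp Require Import zify ring.
Set Implicit Arguments. Unset Strict Implicit. Unset Printing Implicit Defensive.
Import Order.TTheory GRing.Theory Num.Theory.

(* A generalized excited diagram of delta_(n+2k)/delta_n is a filling of delta_n by nonempty
   subsets of {0..k} (how far the descendants of each cell have moved down its diagonal) in
   which all entries of a cell are at most all entries of the cells to its south-east.
   Fixing the maxima P of the sets leaves 2^(P(i,j) - max(P(i-1,j), P(i,j-1))) choices at
   (i,j); in terms of the level sets of P this counts k nested paths, a path having weight 2
   in each row where its cutoff is strictly smaller than the previous cutoff and the row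
   length.

   The sum over nested paths is evaluated row by row as a determinant of Bethe-ansatz type,
   whose m-th row is an m-fold prefix sum of one common sequence psi.  In the nested sum the
   boundary term created by the nesting condition is a multiple of the adjacent row, so it
   disappears from the determinant, and a step of the path only acts on psi by 1 + 2S, with S
   the prefix sum.  On the values L_m of the m-fold prefix sums at the top cutoff, one step is
   the tridiagonal operator (J f)(m) = f(m-1) + 3 f(m) + 2 f(m+1), (J f)(0) = f(0) + 2 f(1).
   Hence the count is the k x k upper left minor of J^n.  For k = 1 this gives s_n = (J^n)(0,0)
   and factoring J^(i+n+j) through the triangular matrices J^i(0,m) and J^j(m,0), with diagonal
   entries 2^i and 1, turns the minor into the Hankel determinant divided by 2^C(k,2). *)

(** * Fillings of the square by sets of displacements *)

Section Fillings.
Variables n k : nat.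

Definition filling := {ffun 'I_n -> {ffun 'I_n -> {set 'I_k.+1}}}.
Implicit Type T : filling.

Definition precedes (a b a' b' : nat) :=
  [&& (a <= a')%N, (b <= b')%N & (a != a') || (b != b')].

(* Cells of the n x n square outside delta_n carry {k}, so the order condition can be imposed
   on the whole square and bounds the entries inside delta_n. *)
Definition valid T := [forall a : 'I_n, forall b : 'I_n,
  [&& T a b != set0, (n <= (a + b).+1)%N ==> (T a b == [set ord_max]) &
   [forall a' : 'I_n, forall b' : 'I_n, precedes a b a' b' ==>
    [forall r in T a b, forall r' in T a' b', (r <= r')%N]]]].

Lemma validP T : reflect
  [/\ forall a b, T a b != set0,
      forall a b : 'I_n, (n <= (a + b).+1)%N -> T a b = [set ord_max] &
      forall (a b a' b' : 'I_n) (r r' : 'I_k.+1), precedes a b a' b' ->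
        r \in T a b -> r' \in T a' b' -> (r <= r')%N]
  (valid T).
Proof.
apply: (iffP 'forall_'forall_and3P) => [val_T | [ne out le]].
  split=> [a b | a b | a b a' b' r r' prec r_ab r_ab']; have [ne out le] := val_T a b => //.
    by move=> le_n; apply/eqP; rewrite le_n in out.
  move: le => /forallP/(_ a')/forallP/(_ b')/implyP/(_ prec)/forall_inP/(_ r r_ab).
  by move/forall_inP; apply.
move=> a b; split; first exact: ne.
  by apply/implyP => /out ->.
apply/forallP => a'; apply/forallP => b'; apply/implyP => prec.
apply/forall_inP => r r_ab; apply/forall_inP => r'; exact: le prec r_ab.
Qed.

End Fillings.

(** * Generalized excited diagrams as valid fillings *)

Section Excited.
Variables n k : nat.
Hypothesis n_gt0 : 0 < n.
Notation N := (n + 2 * k).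
Notation filling := (filling n k).
Implicit Types (T : filling) (a b : 'I_n) (r : 'I_k.+1).

Definition placed T a b r (i j : nat) : bool :=
  [&& (a + b).+1 < n, r \in T a b, i == (a + r).+1 & j == (b + r).+1].

Definition occupied T i j : Prop := exists a b r, placed T a b r i j.

Definition excited T : {set cellT N} :=
  [set c : cellT N | [exists a, exists b, exists r, placed T a b r c.1 c.2]].

Lemma excitedP T (c : cellT N) : reflect (occupied T c.1 c.2) (c \in excited T).
Proof.
rewrite inE; apply: (iffP existsP) => [[a /existsP[b /existsP[r H]]]|[a [b [r H]]]].
  by exists a, b, r.
by exists a; apply/existsP; exists b; apply/existsP; exists r.
Qed.

Lemma placed_cell T a b r i j : placed T a b r i j -> exists c : cellT N, ncell c = (i, j).
Proof.
case/and4P => lt_n _ /eqP -> /eqP ->; have := ltn_ord r => lt_r.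
have lt_i : (a + r).+1 < N by lia.
have lt_j : (b + r).+1 < N by lia.
by exists (Ordinal lt_i, Ordinal lt_j).
Qed.

Lemma memN_excited T i j : reflect (occupied T i j) (memN (excited T) (i, j)).
Proof.
apply: (iffP exists_inP) => [[c /excitedP occ /eqP[<- <-]] //|occ].
have [a [b [r /placed_cell[c def_c]]]] := occ; exists c; last by rewrite def_c.
by apply/excitedP; case: def_c => -> ->.
Qed.

(** Two sources of one position lie on a common diagonal. If they were distinct, the south-eastern
    one would have at least as large a displacement and land strictly farther. *)
Lemma placed_inj T a b r a' b' r' i j : valid T ->
  placed T a b r i j -> placed T a' b' r' i j -> [/\ a = a', b = b' & r = r'].
Proof.
case/validP => _ _ le /and4P[_ Tr /eqP-> /eqP->] /and4P[_ Tr' /eqP eqi /eqP eqj].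
have eq_a : a = a' :> nat.
  have := le a b a' b' _ _ _ Tr Tr'; have := le a' b' a b _ _ _ Tr' Tr.
  rewrite /precedes; case: (ltngtP a a') => // lt_a; lia.
by split; apply: val_inj => //=; lia.
Qed.

Definition update T a b X : filling :=
  [ffun a' => [ffun b' => if (a' == a) && (b' == b) then X else T a' b']].

Lemma updateE T a b X a' b' :
  update T a b X a' b' = if (a' == a) && (b' == b) then X else T a' b'.
Proof. by rewrite !ffunE. Qed.

Lemma precedes_irr a b : precedes a b a b = false.
Proof. by rewrite /precedes !eqxx !andbF. Qed.

Lemma precedesE a b a' b' :
  precedes a b a' b' = [&& a <= a', b <= b' & a + b < a' + b'].
Proof.
rewrite /precedes; apply: andb_id2l => le_a; apply: andb_id2l => le_b.
rewrite [RHS]ltn_neqAle leq_add // andbT -negb_and; congr negb.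
by apply/andP/eqP => [[/eqP-> /eqP->]|eq_s] //; split; apply/eqP; lia.
Qed.

Lemma valid_update T a b X : valid T -> (a + b).+1 < n -> X != set0 ->
  (forall a' b' r r', precedes a' b' a b -> r \in T a' b' -> r' \in X -> r <= r') ->
  (forall a' b' r r', precedes a b a' b' -> r \in X -> r' \in T a' b' -> r <= r') ->
  valid (update T a b X).
Proof.
move=> /validP[ne out le] lt_n neX leX geX; apply/validP; split.
- by move=> a' b'; rewrite updateE; case: ifP.
- move=> a' b' le_n; rewrite updateE ifF ?out //.
  by apply/negP => /andP[/eqP eqa /eqP eqb]; move: le_n; rewrite eqa eqb; lia.
move=> a1 b1 a2 b2 r1 r2 prec; rewrite !updateE.
case: ifP => [/andP[/eqP eqa /eqP eqb]|_]; case: ifP => [/andP[/eqP eqa' /eqP eqb']|_].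
- by move: prec; rewrite eqa eqb eqa' eqb' precedes_irr.
- by apply: geX; rewrite -eqa -eqb.
- by apply: leX; rewrite -eqa' -eqb'.
exact: le.
Qed.

Lemma occupied_update T a b X i j : valid T -> (a + b).+1 < n ->
  occupied (update T a b X) i j <->
  (exists2 r, r \in X & (i, j) = ((a + r).+1, (b + r).+1)) \/
  (occupied T i j /\ forall r, r \in T a b -> (i, j) <> ((a + r).+1, (b + r).+1)).
Proof.
move=> val_T lt_n; split=> [[a' [b' [r']]]|[[r Xr [-> ->]]|[[a' [b' [r' pl]]] ne]]].
- rewrite /placed updateE => /and4P[lt_n']; case: ifP => [/andP[/eqP-> /eqP->]|ne] Xr /eqP-> /eqP->.
    by left; exists r'.
  right; split; first by exists a', b', r'; rewrite /placed lt_n' Xr !eqxx.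
  move=> r Tr [eqi eqj]; have pl' : placed T a' b' r' (a + r).+1 (b + r).+1.
    by rewrite /placed lt_n' Xr -eqi -eqj !eqxx.
  have [|eqa eqb _] := placed_inj val_T pl' (_ : placed T a b r (a + r).+1 (b + r).+1).
    by rewrite /placed lt_n Tr !eqxx.
  by rewrite eqa eqb !eqxx in ne.
- by exists a, b, r; rewrite /placed updateE !eqxx lt_n Xr.
exists a', b', r'; move: pl; rewrite /placed updateE; case: ifP => // /andP[/eqP-> /eqP->].
by case/and4P => _ /ne + /eqP eqi /eqP eqj; rewrite eqi eqj.
Qed.

Definition position a b r : nat * nat := ((a + r).+1, (b + r).+1).

Lemma position_inj a b r r' : position a b r = position a b r' -> r = r'.
Proof. by case=> /addnI eq_r _; apply: val_inj. Qed.

Lemma positionP a b r : (a + b).+1 < n -> exists c : cellT N, ncell c = position a b r.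
Proof.
move=> lt_n; have := ltn_ord r => lt_r.
have lt_i : (a + r).+1 < N by lia.
have lt_j : (b + r).+1 < N by lia.
by exists (Ordinal lt_i, Ordinal lt_j).
Qed.

Lemma ncell_inj : injective (@ncell N).
Proof. by move=> [i j] [i' j'] [/val_inj-> /val_inj->]. Qed.

(** Covers both moves: [Y = T a b] keeps [c] (type II), [Y = T a b :\ r] drops it (type I). It
    serves moves out of a valid filling and the reconstruction of moves into one. *)
Lemma excited_update T a b r r' Y (c c' : cellT N) :
  valid T -> (a + b).+1 < n -> r \in T a b ->
  ncell c = position a b r -> ncell c' = position a b r' ->
  Y = T a b \/ Y = T a b :\ r ->
  let S := excited T in
  excited (update T a b (r' |: Y)) = c' |: (if Y == T a b then S else S :\ c).
Proof.
move=> val_T lt_n Tr def_c def_c' eqY S.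
have occ_T r0 (e : cellT N) : r0 \in T a b -> ncell e = position a b r0 -> e \in S.
  move=> Tr0 [eq1 eq2]; apply/excitedP; exists a, b, r0.
  by rewrite /placed lt_n Tr0 eq1 eq2 !eqxx.
have sub_Y r0 : r0 \in Y -> r0 \in T a b by case: eqY => ->; rewrite // => /setD1P[].
have stay (e : cellT N) : (e \in if Y == T a b then S else S :\ c) <->
    e \in S /\ forall r0, r0 \in T a b -> r0 \notin Y -> ncell e <> position a b r0.
  case: eqP eqY => [-> _|ne [//|->]].
    by split=> [Se|[]//]; split=> // r0 ->.
  split=> [/setD1P[ne_e Se]|[Se ne_e]]; last first.
    rewrite in_setD1 Se andbT; apply/eqP => eq_e; apply: (ne_e r) => //.
      by rewrite !inE eqxx.
    by rewrite eq_e.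
  split=> // r0 Tr0; rewrite !inE Tr0 andbT negbK => /eqP-> eq_e.
  by case/eqP: ne_e; apply: ncell_inj; rewrite eq_e.
apply/setP => e; apply/excitedP/setU1P.
  case/(occupied_update _ _ _ val_T lt_n) => [[r0 /setU1P[->|Yr0] eq_e]|[/excitedP Se ne_e]].
  - by left; apply: ncell_inj; rewrite def_c'.
  - right; apply/stay; split; first exact: occ_T (sub_Y _ Yr0) eq_e.
    by move=> r1 _ /negP nYr1 eq_e'; case: nYr1; rewrite -(position_inj (etrans (esym eq_e) eq_e')).
  right; apply/stay; split=> // r0 Tr0 _; exact: ne_e.
move=> mem_e; apply/(occupied_update _ _ _ val_T lt_n).
case: mem_e => [->|/stay[Se ne_e]].
  by left; exists r'; rewrite ?setU11 // -[LHS]/(ncell c') def_c'.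
have [/exists_inP[r0 Tr0 /eqP eq_e]|no] :=
    boolP [exists r0 in T a b, ncell e == position a b r0].
  left; exists r0 => //; rewrite !inE; apply/orP; right.
  by apply/negPn/negP => nYr0; apply: ne_e eq_e.
right; split=> [|r0 Tr0 eq_e]; first exact/excitedP.
by case/negP: no; apply/exists_inP; exists r0 => //; apply/eqP.
Qed.

Lemma gex_step_valid T S' : valid T -> gex_step (in_delta N) (excited T) S' ->
  exists2 T', valid T' & S' = excited T'.
Proof.
move=> val_T /existsP[c /andP[]]; rewrite /active.
case def_c : (ncell c) => [i j] /and4P[/excitedP[a [b [r pl]]]].
have [ne out le] := validP _ val_T.
case: def_c => def_i def_j; rewrite def_i def_j in pl.
have [lt_n Tr /eqP eqi /eqP eqj] := and4P pl.
move=> /andP[_ /memN_excited free1] /andP[_ /memN_excited free2] /andP[in_d /memN_excited _].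
move=> /existsP[c' /andP[/eqP def_c' eqS']].
have lt_bn : b.+1 < n by lia. have lt_an : a.+1 < n by lia.
(* An entry [r] in the cell below or to the right would occupy [(i+1, j)] or [(i, j+1)], which are
   free. A neighbour outside [delta_n] carries [k], and [r < k] because the target lies in
   [delta_(n+2k)]. *)
have gt_nbr a' b' r' : precedes a b a' b' -> (a + b).+1 = a' + b' -> r' \in T a' b' -> r < r'.
  move=> prec eq_ab Tr'; have le_r := le _ _ _ _ _ _ prec Tr Tr'.
  have [lt_n'|ge_n] := ltnP (a' + b').+1 n.
    rewrite ltn_neqAle le_r andbT; apply/eqP => eq_r.
    have [eq_a|eq_b] : a' = a.+1 :> nat /\ b' = b :> nat \/ a' = a :> nat /\ b' = b.+1 :> nat.
        by move: prec; rewrite precedesE; lia.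
      apply: free1; exists a', b', r'; rewrite /placed lt_n' Tr'; lia.
    apply: free2; exists a', b', r'; rewrite /placed lt_n' Tr'; lia.
  move: Tr'; rewrite out // => /set1P ->; move: in_d; rewrite /in_delta /=; lia.
(* Every later cell lies weakly south-east of one of the two neighbours. *)
have gt_all a' b' r' : precedes a b a' b' -> r' \in T a' b' -> r < r'.
  move=> prec Tr'.
  have [na [nb [prec_n eq_n le_na le_nb]]] : exists na nb : 'I_n,
      [/\ precedes a b na nb, (a + b).+1 = na + nb, na <= a' & nb <= b'].
    have [lt_a|ge_a] := ltnP a a'.
      exists (Ordinal lt_an), b; rewrite precedesE /=; case/and3P: prec => _ le_b _.
      by clear -lt_a le_b; split; lia.
    exists a, (Ordinal lt_bn); rewrite precedesE /=; rewrite precedesE in prec.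
    by clear -ge_a prec; split; lia.
  have [/andP[/eqP eq_a /eqP eq_b]|ne_n] := boolP ((na == a') && (nb == b')).
    by apply: gt_nbr prec_n eq_n _; rewrite eq_a eq_b.
  have /set0Pn[u Tu] := ne na nb.
  apply: leq_trans (gt_nbr _ _ _ prec_n eq_n Tu) (le _ _ _ _ _ _ _ Tu Tr').
  by move: ne_n; rewrite precedesE le_na le_nb -!val_eqE /=; clear -le_na le_nb; lia.
have lt_k : r < k.
  have /set0Pn[u Tu] := ne (Ordinal lt_an) b.
  have := gt_all (Ordinal lt_an) b u; rewrite Tu /precedes /= => lt_u.
  have := ltn_ord u; lia.
pose r1 : 'I_k.+1 := Ordinal (lt_k : r.+1 < k.+1).
have val_upd (Y : {set 'I_k.+1}) : Y \subset T a b -> valid (update T a b (r1 |: Y)).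
  move=> /subsetP sub_Y; apply: valid_update => //.
  - by apply/set0Pn; exists r1; rewrite setU11.
  - move=> a' b' s s' prec Ts /setU1P[->|/sub_Y]; last exact: le prec Ts.
    by apply: leqW; apply: le prec Ts Tr.
  move=> a' b' s s' prec /setU1P[->|/sub_Y Ts] Ts'; last exact: le prec Ts Ts'.
  exact: gt_all prec Ts'.
have def_c : ncell c = position a b r by rewrite /ncell def_i def_j eqi eqj.
have {}def_c' : ncell c' = position a b r1 by rewrite def_c' eqi eqj /position /= !addnS.
case/orP: eqS' => /eqP ->.
  exists (update T a b (r1 |: (T a b :\ r))); first by apply: val_upd; apply: subsetDl.
  rewrite (excited_update val_T lt_n Tr def_c def_c') ?ifF //; last by right.
  by apply/negbTE/eqP => /setP/(_ r); rewrite !inE eqxx Tr.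
exists (update T a b (r1 |: T a b)); first exact: val_upd.
by rewrite (excited_update val_T lt_n Tr def_c def_c') ?eqxx //; left.
Qed.

Definition origin : filling :=
  [ffun a : 'I_n => [ffun b : 'I_n => if (a + b).+1 < n then [set ord0] else [set ord_max]]].

Lemma valid_origin : valid origin.
Proof.
apply/validP; split=> [a b|a b le_n|a b a' b' r r' prec].
- by rewrite !ffunE; case: ifP => _; rewrite -card_gt0 cards1.
- by rewrite !ffunE ltnNge le_n.
rewrite !ffunE; case: ifP => [_ /set1P->|ge_n /set1P->] //.
by rewrite ifF => [/set1P->|] //; move: prec; rewrite precedesE; lia.
Qed.

Lemma excited_origin T :
  (forall a b, (a + b).+1 < n -> T a b = [set ord0]) ->
  excited T = diagram N (in_delta n).
Proof.
move=> T0; apply/setP => -[i j]; rewrite [RHS]inE /in_delta /=.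
apply/excitedP/and3P => [[a [b [r /and4P[lt_n]]]]|[i_gt0 j_gt0 le_j]].
  rewrite T0 // => /set1P-> /eqP-> /eqP->; split=> //=; lia.
have lt_a : i.-1 < n by lia.
have lt_b : j.-1 < n by lia.
exists (Ordinal lt_a), (Ordinal lt_b), ord0; rewrite /placed T0 ?inE ?eqxx /=; lia.
Qed.

(** Potential that drops when a move is undone. *)
Definition height T := \sum_a \sum_b \sum_(r in T a b) r.

Lemma height_update T a b (X : {set 'I_k.+1}) : \sum_(r in X) r < \sum_(r in T a b) r ->
  height (update T a b X) < height T.
Proof.
move=> lt_X; rewrite /height (bigD1 a) // [X in _ < X](bigD1 a) //=.
rewrite (bigD1 b) // [X in _ < X + _](bigD1 b) //= updateE !eqxx /=.
rewrite -!addnA -addSn leq_add // leq_add //; apply/eq_leq.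
  by apply: eq_bigr => b' /negPf ne_b; rewrite updateE ne_b andbF.
by apply: eq_bigr => a' /negPf ne_a; apply: eq_bigr => b' _; rewrite updateE ne_a.
Qed.

(** Replacing a positive entry [r] by [r - 1] in a suitable cell undoes a type I move, or a type II
    move when [r - 1] is already present. *)
Lemma gex_step_down T : valid T ->
  (forall a b, (a + b).+1 < n -> T a b = [set ord0]) \/
  exists T0, [/\ valid T0, gex_step (in_delta N) (excited T0) (excited T) & height T0 < height T].
Proof.
move=> val_T.
pose raised (c : 'I_n * 'I_n) := ((c.1 + c.2).+1 < n) && (T c.1 c.2 != [set ord0]).
have [c0 raised_c0|none] := pickP raised; [right|left]; last first.
  by move=> a b lt_n; apply/eqP; have := none (a, b); rewrite /raised /= lt_n => /negbFE.
(* Minimality of [a + b] makes all preceding cells carry [{0}], so lowering an entry here cannot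
   break the order condition. *)
case: (@arg_minnP _ c0 raised (fun c => c.1 + c.2) raised_c0) => -[a b] /= /andP[/= lt_n neT] min_ab.
have [ne out le] := validP _ val_T.
have below a' b' : precedes a' b' a b -> T a' b' = [set ord0].
  move=> prec; apply/eqP/negPn/negP => ne_T.
  have := min_ab (a', b'); rewrite /raised /= ne_T andbT.
  by move: prec; rewrite precedesE; lia.
have [r Tr r_gt0] : exists2 r, r \in T a b & 0 < r.
  have /set0Pn[u Tu] := ne a b; have [u0|] := posnP u; last by exists u.
  apply/exists_inP; apply: contraR neT => /exists_inPn le0; apply/eqP/setP => s.
  rewrite inE; apply/idP/eqP => [/le0|->]; last by rewrite (_ : ord0 = u) //; apply: val_inj.
  by rewrite -eqn0Ngt => /eqP s0; apply: val_inj.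
have lt_r' : r.-1 < k.+1 by have := ltn_ord r; lia.
pose r' : 'I_k.+1 := Ordinal lt_r'.
pose Y := T a b :\ r; pose T0 := update T a b (r' |: Y).
have val_T0 : valid T0.
  apply: valid_update => //.
  - by apply/set0Pn; exists r'; rewrite setU11.
  - by move=> a' b' s s' /below -> /set1P->.
  move=> a' b' s s' prec /setU1P[->|/setD1P[_ Ts]] Ts'; last exact: le prec Ts Ts'.
  by apply: leq_trans (leq_pred _) (le _ _ _ _ _ _ prec Tr Ts').
have ne_r : r' != r by rewrite -val_eqE /=; lia.
exists T0; split=> //; last first.
  apply: height_update; rewrite [X in _ < X](big_setD1 r) //= -/Y.
  have [Yr'|nYr'] := boolP (r' \in Y); first by rewrite (setUidPr _) ?sub1set //; lia.
  by rewrite big_setU1 // ltn_add2r /= ltn_predL.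
have def_T : T = update T0 a b (r |: Y).
  rewrite /Y setD1K //; apply/ffunP => a'; apply/ffunP => b'; rewrite !updateE.
  by case: (a' =P a) => [->|_]; case: (b' =P b) => [->|_]; rewrite ?andbF.
have [c def_c] := positionP r' lt_n; have [c' def_c'] := positionP r lt_n.
have T0r' : r' \in T0 a b by rewrite updateE !eqxx setU11.
have eqY : Y = T0 a b \/ Y = T0 a b :\ r'.
  rewrite updateE !eqxx; have [Yr'|nYr'] := boolP (r' \in Y).
    by left; apply/esym/setUidPr; rewrite sub1set.
  by right; rewrite setU1K.
have eqS := excited_update val_T0 lt_n T0r' def_c def_c' eqY.
rewrite -def_T in eqS; rewrite /= in eqS.
have Sc : c \in excited T0.
  case: (def_c) => eq1 eq2; apply/excitedP; exists a, b, r'.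
  by rewrite /placed lt_n T0r' eq1 eq2 !eqxx.
(* An occupant coming from a preceding cell has displacement 0 and falls short, one from a later
   cell has displacement at least [r] and overshoots, and one from an incomparable cell is at least
   two diagonals away. *)
have free e1 e2 : 0 < e1 + e2 -> e1 <= 1 -> e2 <= 1 ->
    freeN (in_delta N) (excited T0) (a + r + e1, b + r + e2).
  move=> gt0 le1 le2; have lt_r := ltn_ord r; rewrite /freeN; apply/andP; split.
    by rewrite /in_delta /=; clear -lt_n lt_r gt0 le1 le2 r_gt0; lia.
  apply/memN_excited => -[a1 [b1 [r1]]]; rewrite /placed updateE => /and4P[_].
  case: ifP => [/andP[/eqP-> /eqP->]|ne_ab] X1 /eqP eqi /eqP eqj.
    have eq_r : r1 = r by apply: val_inj; clear -eqi eqj gt0 le1 le2; rewrite /=; lia.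
    by move: X1; rewrite !inE eq_r eqxx orbF eq_sym (negPf ne_r).
  have {}ne_ab : ~ (a1 = a :> nat /\ b1 = b :> nat).
    by case=> /val_inj eq_a /val_inj eq_b; rewrite eq_a eq_b !eqxx in ne_ab.
  have [/andP[le_a le_b]|not_le] := boolP ((a1 <= a) && (b1 <= b)).
    have prec : precedes a1 b1 a b by rewrite precedesE le_a le_b; clear -le_a le_b ne_ab; lia.
    move: X1; rewrite (below _ _ prec) => /set1P r1_0; rewrite r1_0 /= in eqi eqj.
    by clear -eqi eqj le_a le_b gt0 le1 le2 r_gt0 ne_ab; lia.
  have le_r : a <= a1 -> b <= b1 -> r <= r1.
    move=> ge_a ge_b; apply: le Tr X1; rewrite precedesE ge_a ge_b; clear -ge_a ge_b ne_ab; lia.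
  have [ge_a|lt_a] := leqP a a1; have [ge_b|lt_b] := leqP b b1.
  - by have := le_r ge_a ge_b; clear -eqi eqj ge_a ge_b ne_ab le1 le2; lia.
  - by clear -eqi eqj ge_a lt_b le1 le2 not_le; lia.
  - by clear -eqi eqj lt_a ge_b le1 le2 not_le; lia.
  by rewrite (ltnW lt_a) (ltnW lt_b) in not_le.
apply/existsP; exists c; apply/andP; split.
  rewrite /active def_c /= Sc.
  have succ_r x : (x + r.-1).+1 = x + r by rewrite -addnS prednK.
  have := free 1 0; have := free 0 1; have := free 1 1.
  by rewrite !addn0 !addn1 !succ_r => -> // -> // ->.
apply/existsP; exists c'; rewrite def_c' def_c /position /= eqS; apply/andP; split.
  by rewrite -!addnS prednK // !addn1 eqxx.
by case: ifP => _; rewrite eqxx ?orbT.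
Qed.

Lemma connect_excited T : valid T ->
  connect (gex_step (in_delta N)) (diagram N (in_delta n)) (excited T).
Proof.
have [m] := ubnP (height T); elim: m T => // m IH T; rewrite ltnS => le_m val_T.
case: (gex_step_down val_T) => [/excited_origin -> //|[T0 [val_T0 step lt_T0]]].
by apply: connect_trans (IH T0 (leq_trans lt_T0 le_m) val_T0) (connect1 step).
Qed.

Lemma connect_valid S : connect (gex_step (in_delta N)) (diagram N (in_delta n)) S ->
  exists2 T, valid T & S = excited T.
Proof.
case/connectP => p path_p ->; have : exists2 T, valid T & diagram N (in_delta n) = excited T.
  exists origin; first exact: valid_origin.
  by rewrite (@excited_origin origin) // => a b lt_n; rewrite !ffunE lt_n.
elim: p (diagram _ _) path_p => //= S1 p IH S0 /andP[step path_p] [T val_T def_S0].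
by apply: IH path_p _; rewrite def_S0 in step; case: (gex_step_valid val_T step) => T' ? ?; exists T'.
Qed.

(* Infinite descent: a position decoded by two different cells (a, b) < (a', b') forces another
   one, decoded in [T'] by the right neighbour of (a, b) and in [T] by a cell of row < a. *)
Lemma displaced_absurd m T T' a b a' b' r r' : valid T -> valid T' ->
  excited T = excited T' -> a < m -> (a' + b').+1 < n ->
  r \in T a b -> r' \in T' a' b' -> a < a' -> a + r = a' + r' -> b + r = b' + r' -> False.
Proof.
move=> val_T val_T' eqS; elim: m a b a' b' r r' => // m IH a b a' b' r r' lt_am lt_n Tr Tr' lt_a eq_a eq_b.
have [ne out le] := validP _ val_T; have [ne' out' le'] := validP _ val_T'.
have lt_b : b.+1 < n by have := ltn_ord b'; lia.
have /set0Pn[u T'u] := ne' a (Ordinal lt_b).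
have le_u : u <= r' by apply: le' T'u Tr'; rewrite /precedes /=; lia.
have lt_n' : (a + b.+1).+1 < n by lia.
have [c def_c] := @positionP a (Ordinal lt_b) u lt_n'.
have : c \in excited T'.
  case: def_c => eq1 eq2; apply/excitedP; exists a, (Ordinal lt_b), u.
  by rewrite /placed /= lt_n' T'u eq1 eq2 /= !eqxx.
rewrite -eqS => /excitedP[a2 [b2 [r2 /and4P[lt_n2 Tr2]]]].
case: def_c => /= -> -> /eqP eq1 /eqP eq2.
have [lt_a2|ge_a2] := ltnP a2 a.
  by apply: (IH a2 b2 a (Ordinal lt_b) r2 u) => //=; lia.
have := le _ _ _ _ _ _ _ Tr Tr2; rewrite precedesE; lia.
Qed.

(** If two fillings decoded a position by different cells, these would share a diagonal with one of
    them north-west of the other; [displaced_absurd] excludes both orders. *)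
Lemma excited_inj : {in [set T : filling | valid T] &, injective excited}.
Proof.
suff sub T T' a b : valid T -> valid T' -> excited T = excited T' -> T a b \subset T' a b.
  move=> T T'; rewrite !inE => val_T val_T' eqS; apply/ffunP => a; apply/ffunP => b.
  by apply/eqP; rewrite eqEsubset !sub.
move=> val_T val_T' eqS; have [lt_n|ge_n] := ltnP (a + b).+1 n; last first.
  by have [_ -> //] := validP _ val_T; have [_ -> //] := validP _ val_T'.
apply/subsetP => r Tr; have [c def_c] := positionP r lt_n.
have : c \in excited T.
  case: def_c => eq1 eq2; apply/excitedP; exists a, b, r.
  by rewrite /placed lt_n Tr eq1 eq2 !eqxx.
rewrite eqS => /excitedP[a' [b' [r' /and4P[lt_n' Tr']]]].
case: def_c => /= -> -> /eqP eq1 /eqP eq2.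
case: (ltngtP a a') => [lt_a|lt_a|eq_a].
- by case: (@displaced_absurd n T T' a b a' b' r r'); rewrite ?ltn_ord //; lia.
- by case: (@displaced_absurd n T' T a' b' a b r' r); rewrite ?ltn_ord //; lia.
have -> : a = a' by apply: val_inj.
have -> : b = b' by apply: val_inj => /=; lia.
by have -> : r = r' by apply: val_inj => /=; lia.
Qed.

Lemma nGED_valid : nGED N n = #|[set T : filling | valid T]|.
Proof.
rewrite /nGED -(card_in_imset excited_inj); apply: eq_card => S.
rewrite inE; apply/idP/imsetP => [/connect_valid[T val_T ->]|[T]].
  by exists T; rewrite ?inE.
by rewrite inE => /connect_excited ? ->.
Qed.

End Excited.

Local Open Scope ring_scope.

(** * Iterated prefix sums and the tridiagonal operator *)

Section PrefixSums.
Variable V : zmodType.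
Implicit Types (g : nat -> V) (u m M N d : nat).

Definition psum g u : V := \sum_(w < u) g w.
Definition psums m g : nat -> V := iter m psum g.
Definition clift M g u : V := g (minn u M) + psum g (minn u M) *+ 2.
(* [psi] after [N] steps, with indices shifted by [d] so that its support starts at [0]; the
   cap makes it constant from the top index on. *)
Fixpoint prof d g0 N : nat -> V :=
  if N is N'.+1 then clift (N' + d) (prof d g0 N') else g0.
Definition jac (phi : nat -> V) m : V :=
  (if m is m'.+1 then phi m' + phi m *+ 3 else phi 0%N) + phi m.+1 *+ 2.

Lemma psumS g u : psum g u.+1 = psum g u + g u.
Proof. by rewrite /psum big_ord_recr. Qed.

Lemma eq_psums m g h u : g =1 h -> psums m g u = psums m h u.
Proof.
by move=> eq_gh; elim: m u => [//|m IH] u; apply: eq_bigr => w _; apply: IH.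
Qed.

Lemma psumsS m g u : psums m.+1 g u.+1 = psums m.+1 g u + psums m g u.
Proof. exact: psumS. Qed.

Lemma psums_small m g u : (u < m)%N -> psums m g u = 0.
Proof.
elim: m u => [//|m IH] u lt_um; rewrite /psums iterS /psum big1 // => w _.
by apply: IH; have := ltn_ord w; lia.
Qed.

(** [1 + 2S] commutes with the prefix sum [S], and up to [M] the cap is not felt. *)
Lemma psums_clift m M g u : (u <= M)%N ->
  psums m (clift M g) u = psums m g u + psums m.+1 g u *+ 2.
Proof.
elim: m u => [|m IH] u le_uM; first by rewrite /psums /= /clift (minn_idPl le_uM).
rewrite /psums !iterS /psum.
under eq_bigr => w _ do rewrite -/(psums m _ _) IH ?(leq_trans (ltnW (ltn_ord w))) //.
by rewrite big_split /= sumrMnl.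
Qed.

(** Raising the top by one turns the [(m+1)]-fold sum into [L_(m+1) + L_m]; applying [1 + 2S] to
    both gives the coefficients 1, 3, 2. For [m = 0] the cap freezes the value, which leaves
    [L_0 + 2 L_1]. *)
Lemma psums_jac d g0 m N :
  psums m (prof d g0 N) (N + d) = iter N jac (fun i => psums i g0 d) m.
Proof.
elim: N m => [//|N IH] m.
have top i u : u = (N + d)%N -> psums i (prof d g0 N.+1) u =
   iter N jac (fun i => psums i g0 d) i + iter N jac (fun i => psums i g0 d) i.+1 *+ 2.
  by move=> ->; rewrite [prof _ _ _]/= psums_clift // !IH.
rewrite iterS; case: m => [|m].
  rewrite /psums /= /clift (_ : minn _ _ = (N + d)%N); last by lia.
  by rewrite /jac -!IH.
by rewrite addSn psumsS !top // /jac [LHS]addrC addrA -[X in X + _]addrA -mulrSr.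
Qed.

End PrefixSums.
Arguments psums : simpl never.

(** * Weighted sums over nested cutoffs *)

Section NestedSums.

Definition corner (e : nat) : rat := if e == 0%N then 1 else 2.

(* [xs] and [ys] are decreasing; the largest entry [y] is summed innermost, which is what lets
   the nesting condition [head 0 ys <= y] be removed one determinant row at a time. *)
Fixpoint nsum (xs : seq nat) (F : seq nat -> rat) : rat :=
  if xs is x :: xs' then
    nsum xs' (fun ys => \sum_(head 0%N ys <= y < x.+1) corner (x - y) * F (y :: ys))
  else F [::].

(** [N'] is the number of staircase cells in the current row; the previous cutoffs are truncated to
    it before new ones are chosen below them. *)
Fixpoint nests (N : nat) (xs : seq nat) : rat :=
  if N is N'.+1 then nsum (map (minn N') xs) (nests N') else 1.

Lemma sorted_geq_head (s : seq nat) y : sorted geq s -> y \in s -> (y <= head 0 s)%N.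
Proof.
have geq_trans : transitive geq by move=> ? ? ?; rewrite /geq /= => ? ?; lia.
case: s => //= x s; rewrite (path_sortedE geq_trans) inE => /andP[/allP le_s _].
by case/predU1P => [->//|/le_s].
Qed.

Lemma eq_nsum xs F F' :
  (forall ys, size ys = size xs -> sorted geq ys ->
     (head 0 ys <= head 0 xs)%N -> F ys = F' ys) ->
  nsum xs F = nsum xs F'.
Proof.
elim: xs F F' => [|x xs IH] F F' eqF /=; first exact: eqF.
apply: IH => ys size_ys sorted_ys le_h.
apply: eq_big_nat => y /andP[le_hy lt_yx]; congr (_ * _); apply: eqF => //=.
  by rewrite size_ys.
by case: ys sorted_ys le_hy {size_ys le_h} => //= z ys -> ; rewrite /geq /= => ->.
Qed.

End NestedSums.
Arguments nsum : simpl never.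

(** * Row determinants evaluating the nested sums *)

Lemma psums_delta0 (m w u : nat) : (u < w + m)%N ->
  psums m (fun v => (v == w)%:R : rat) u = 0.
Proof.
elim: m u => [|m IH] u lt_u; first by rewrite /psums /= ltn_eqF // -(addn0 w).
by rewrite /psums iterS /psum big1 // => v _; apply: IH; have := ltn_ord v; lia.
Qed.

Lemma psums_delta1 (m w : nat) : psums m (fun v => (v == w)%:R : rat) (w + m) = 1.
Proof.
elim: m => [|m IH]; first by rewrite /psums /= addn0 eqxx.
by rewrite addnS psumsS IH psums_delta0 ?add0r //; lia.
Qed.

Section Rows.
Variable d : nat.
Notation V := 'rV[rat]_d.+1.
Implicit Types (g : nat -> V) (pre post : seq V) (xs : seq nat).

(** The rows form a list, so that they can be split as [pre ++ v :: post] and treated one at a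
    time. *)
Definition rowdet (l : seq V) : rat := \det (\matrix_(i < d.+1) nth 0 l i).

Lemma rowdet_lin pre post a b u v : (size pre <= d)%N ->
  rowdet (pre ++ (a *: u + b *: v) :: post) =
  a * rowdet (pre ++ u :: post) + b * rowdet (pre ++ v :: post).
Proof.
move=> le_pre; have lt_pre : (size pre < d.+1)%N by [].
have aux w w' : row' (Ordinal lt_pre) (\matrix_(i < d.+1) nth 0 (pre ++ w :: post) i) =
   row' (Ordinal lt_pre) (\matrix_(i < d.+1) nth 0 (pre ++ w' :: post) i).
  apply/matrixP => i j; rewrite !mxE !nth_cat; case: ltnP => // le_i.
  rewrite (_ : (_ - _)%N = (lift (Ordinal lt_pre) i - size pre).-1.+1) //.
  by move: (neq_lift (Ordinal lt_pre) i) le_i; rewrite -val_eqE /=; lia.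
apply: (determinant_multilinear (i0 := Ordinal lt_pre)); rewrite ?aux //.
by apply/rowP => j; rewrite !mxE /= !nth_cat ltnn subnn /= !mxE.
Qed.

Lemma rowdet_alt pre post v : (size pre < d)%N ->
  rowdet (pre ++ v :: v :: post) = 0.
Proof.
move=> lt_pre; have lt1 : (size pre < d.+1)%N by lia.
apply: (@determinant_alternate _ _ _ (Ordinal lt1) (Ordinal (lt_pre : (size pre).+1 < d.+1)%N)).
  by rewrite -val_eqE /=; lia.
by move=> j; rewrite !mxE !nth_cat /= ltnn subnn ltnNge leqnSn /= subSnn.
Qed.

Lemma rowdet_sum pre post (I : Type) (r : seq I) (P : pred I) (a : I -> rat) (u : I -> V) :
  (size pre <= d)%N ->
  rowdet (pre ++ (\sum_(i <- r | P i) a i *: u i) :: post) =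
  \sum_(i <- r | P i) a i * rowdet (pre ++ u i :: post).
Proof.
move=> le_pre; elim: r => [|i r IH].
  rewrite !big_nil; have := rowdet_lin post 0 0 0 0 le_pre.
  by rewrite !scale0r addr0 !mul0r addr0.
rewrite !big_cons; case: ifP => // _; rewrite -IH.
have := rowdet_lin post (a i) 1 (u i) (\sum_(j <- r | P j) a j *: u j) le_pre.
by rewrite scale1r mul1r.
Qed.

Lemma rowdet_addl pre post v w a : (size pre < d)%N ->
  rowdet (pre ++ (v + a *: w) :: w :: post) = rowdet (pre ++ v :: w :: post).
Proof.
move=> lt_pre; have := rowdet_lin (w :: post) 1 a v w (ltnW lt_pre).
by rewrite scale1r mul1r rowdet_alt // mulr0 addr0.
Qed.

Lemma rowdet_addr pre post v w : (size pre < d)%N ->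
  rowdet (pre ++ v :: (w + v) :: post) = rowdet (pre ++ v :: w :: post).
Proof.
move=> lt_pre; rewrite -!cat_rcons.
have := @rowdet_lin (rcons pre v) post 1 1 w v; rewrite size_rcons => /(_ lt_pre).
by rewrite !scale1r !mul1r !cat_rcons rowdet_alt // addr0.
Qed.

Fixpoint rows g m xs : seq V :=
  if xs is x :: xs' then psums m g (x + d) :: rows g m.+1 xs' else [::].

(** The terms [y < x], of weight 2, add up to twice a difference of prefix sums. The term at [h] is
    the boundary term that a row operation removes. *)
Lemma sum_corner g m h x : (h <= x)%N ->
  \sum_(h <= y < x.+1) corner (x - y) *: psums m g (y + d) =
  psums m g (x + d) + psums m.+1 g (x + d) *+ 2 - psums m.+1 g (h + d) *+ 2.
Proof.
elim: x => [|x IH] le_hx.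
  have -> : h = 0%N by lia.
  by rewrite big_nat1 addrK subnn scale1r.
rewrite big_nat_recr //= subnn scale1r.
have corner2 y : (y <= x)%N -> corner (x.+1 - y) = 2.
  by rewrite /corner; case: eqP => //; lia.
move: le_hx; rewrite leq_eqVlt => /orP[/eqP <-|lt_hx].
  by rewrite big_geq // add0r addrK.
have eqS (X : V) : \sum_(h <= y < x.+1) corner (x.+1 - y) *: psums m g (y + d) =
   \sum_(h <= y < x.+1) corner (x - y) *: psums m g (y + d) + psums m g (x + d).
  rewrite !big_nat_recr //= corner2 // subnn scale1r scaler_nat mulr2n addrA.
  congr (_ + _ + _); apply: eq_big_nat => y /andP[_ lt_yx].
  by rewrite corner2 1?ltnW // /corner ifF //; lia.
rewrite (eqS 0) IH // addSn psumsS mulrnDl.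
set a := psums _ _ _; set b := psums _ _ _; set c := psums _ _ _; set e := psums _ _ _.
rewrite mulr2n [in RHS]mulr2n; by apply/rowP => i; rewrite !mxE; ring.
Qed.

(** The rows in [pre] are already summed. Summing the next variable lifts its row, up to twice a
    prefix sum of one order more at [head 0 ys], which is exactly the row below. *)
Lemma nsum_rows g N pre xs : (size pre + size xs = d.+1)%N ->
  sorted geq xs -> (head 0 xs <= N)%N ->
  nsum xs (fun ys => rowdet (pre ++ rows g (size pre) ys)) =
  rowdet (pre ++ rows (clift (N + d) g) (size pre) xs).
Proof.
elim: xs pre => [//|x xs IH] pre /= size_pre sorted_xs le_xN.
rewrite /nsum -/nsum.
have le_h : (head 0 xs <= x)%N by case: (xs) sorted_xs => //= y ys /andP[].
rewrite (@eq_nsum _ _ (fun ys =>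
  rowdet (rcons pre (psums (size pre) (clift (N + d) g) (x + d)) ++
          rows g (size (rcons pre (psums (size pre) (clift (N + d) g) (x + d)))) ys))).
  rewrite IH ?size_rcons ?cat_rcons //; first by lia.
    exact: path_sorted sorted_xs.
  exact: leq_trans le_h le_xN.
move=> ys size_ys sorted_ys le_ys.
have le_yx : (head 0 ys <= x)%N by exact: leq_trans le_h.
rewrite -rowdet_sum; last by lia.
rewrite sum_corner // size_rcons cat_rcons psums_clift; last by lia.
(* Without a row below, the lower limit is 0 and the boundary term is a [(d+1)]-fold prefix sum at
   [d], hence zero. *)
case: ys size_ys {sorted_ys le_ys le_yx} => [|y ys] /= size_ys.
  by rewrite add0n (@psums_small _ (size pre).+1 g d) ?mul0rn ?subr0 //; lia.
by rewrite -[X in _ - X]scaler_nat -scaleNr rowdet_addl //; lia.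
Qed.

(** Entries [N.+1] form an initial block. The row of such an entry is its value at [N + d] plus the
    prefix sum of one order less there, which is the row above; in the first row the cap makes both
    values equal. *)
Lemma rows_top g N pre xs : (size pre + size xs = d.+1)%N ->
  sorted geq xs -> (head 0 xs <= N.+1)%N ->
  (pre != [::] -> last 0 pre = psums (size pre).-1 (clift (N + d) g) (N + d)) ->
  rowdet (pre ++ rows (clift (N + d) g) (size pre) (map (minn N) xs)) =
  rowdet (pre ++ rows (clift (N + d) g) (size pre) xs).
Proof.
elim: xs pre => [//|x xs IH] pre /= size_pre sorted_xs le_xN last_pre.
have map_id : (x <= N)%N -> map (minn N) xs = xs.
  move=> le_x; rewrite -[RHS]map_id; apply/eq_in_map => y y_xs; apply/minn_idPr.
  by apply: leq_trans (@sorted_geq_head (x :: xs) y sorted_xs _) le_x; rewrite inE y_xs orbT.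
have [le_x|lt_x] := leqP x N; first by rewrite map_id // (minn_idPr le_x).
have {le_xN lt_x} eq_x : x = N.+1 by lia.
rewrite {x}eq_x in sorted_xs map_id *.
set h := clift (N + d) g in last_pre *.
have := IH (rcons pre (psums (size pre) h (N + d))).
rewrite size_rcons last_rcons cat_rcons -/h => ->; first last.
- by [].
- by case: (xs) sorted_xs => //= y ys /andP[].
- exact: path_sorted sorted_xs.
- by lia.
rewrite cat_rcons; case: (lastP pre) last_pre size_pre => [|pre' z] last_pre size_pre.
  congr rowdet; rewrite /= /psums /= /h /clift; congr (_ :: _).
  by rewrite minnn addSn (minn_idPr (leqnSn _)).
rewrite size_rcons last_rcons in last_pre size_pre *.
rewrite last_pre; last by case: (pre').
rewrite addSn psumsS /= !cat_rcons.
by rewrite rowdet_addr //; lia.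
Qed.

(** Initial sequence of unit rows in reversed order, chosen so that its prefix sums at [d] form a
    unitriangular matrix. *)
Definition base u : V := \row_(j < d.+1) (u == (d - j)%N)%:R.

Lemma nth_rows g m xs i : (i < size xs)%N ->
  nth 0 (rows g m xs) i = psums (m + i) g (nth 0%N xs i + d).
Proof.
elim: xs m i => [//|x xs IH] m [|i] lt_i /=; first by rewrite addn0.
by rewrite IH // addnS.
Qed.

Lemma psums_entry m g u j : psums m g u 0 j = psums m (fun v => g v 0 j) u.
Proof.
elim: m u => [//|m IH] u; rewrite /psums !iterS /psum summxE.
by apply: eq_bigr => w _; apply: IH.
Qed.

Lemma rowdet_base : rowdet (rows base 0 (nseq d.+1 0%N)) = 1.
Proof.
rewrite /rowdet -det_tr det_trig.
  rewrite big1 // => i _; rewrite !mxE nth_rows ?size_nseq // nth_nseq ltn_ord.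
  rewrite psums_entry -[RHS](psums_delta1 i (d - i)) !add0n subnK -1?ltnS //.
  by apply: eq_psums => v; rewrite mxE.
apply/is_trig_mxP => i j lt_ij; rewrite !mxE nth_rows ?size_nseq // nth_nseq ltn_ord.
rewrite psums_entry -[RHS](@psums_delta0 j (d - i) (0 + d)); last by lia.
by apply: eq_psums => v; rewrite mxE.
Qed.

Lemma nests_rowdet N xs : size xs = d.+1 -> sorted geq xs -> (head 0 xs <= N)%N ->
  nests N xs = rowdet (rows (prof d base N) 0 xs).
Proof.
elim: N xs => [|N IH] xs size_xs sorted_xs le_xN /=.
  rewrite (_ : xs = nseq d.+1 0%N) ?rowdet_base // -size_xs.
  by apply/all_pred1P; apply/allP => x /(sorted_geq_head sorted_xs) /=; lia.
have sorted_min : sorted geq (map (minn N) xs).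
  apply: homo_sorted sorted_xs => x y; rewrite /geq /= => ?; lia.
have le_min : (head 0 (map (minn N) xs) <= N)%N.
  by case: (xs) => //= x ?; rewrite geq_minl.
rewrite -(@rows_top _ _ [::]) //.
rewrite -(@nsum_rows _ _ [::]) ?size_map //.
apply: eq_nsum => ys size_ys sorted_ys le_ys; apply: IH => //.
  by rewrite size_ys size_map.
exact: leq_trans le_ys le_min.
Qed.

End Rows.

(** * Powers of the tridiagonal operator and the Hankel determinant *)

Definition jacm n m l : rat := iter n (@jac rat) (fun i => (i == l)%:R) m.

Lemma jacmS0 n l : jacm n.+1 0 l = jacm n 0 l + jacm n 1 l *+ 2.
Proof. by []. Qed.

Lemma jacmSS n m l :
  jacm n.+1 m.+1 l = jacm n m l + jacm n m.+1 l *+ 3 + jacm n m.+2 l *+ 2.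
Proof. by []. Qed.

(** In [n] steps [jac] reaches from [m] no index above [m + n], so the infinite matrix product may
    be cut at any larger [K]. *)
Lemma iter_jac (V : lmodType rat) (phi : nat -> V) n m K : (m + n < K)%N ->
  iter n (@jac V) phi m = \sum_(l < K) jacm n m l *: phi l.
Proof.
elim: n m => [|n IH] m lt_K.
  rewrite addn0 in lt_K; rewrite (bigD1 (Ordinal lt_K)) //= /jacm /= eqxx scale1r.
  rewrite big1 ?addr0 // => l; rewrite -val_eqE /= eq_sym => /negPf->.
  by rewrite scale0r.
have expand a b : \sum_(l < K) (a l + b l *+ 2) *: phi l =
    \sum_(l < K) a l *: phi l + (\sum_(l < K) b l *: phi l) *+ 2 :> V.
  by rewrite -sumrMnl -big_split; apply: eq_bigr => l _; rewrite scalerDl scalerMnl.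
case: m lt_K => [|m] lt_K; rewrite iterS [LHS]/jac !IH; try lia.
  by under [RHS]eq_bigr => l _ do rewrite jacmS0; rewrite expand.
under [RHS]eq_bigr => l _ do rewrite jacmSS; rewrite expand; congr (_ + _).
rewrite -sumrMnl -big_split; apply: eq_bigr => l _ /=; by rewrite scalerDl scalerMnl.
Qed.

Lemma nests_jacm n d : nests n (nseq d.+1 n) = \det (\matrix_(m < d.+1, l < d.+1) jacm n m l).
Proof.
rewrite (@nests_rowdet d) ?size_nseq //; last first.
  by elim: d => //= d IH; rewrite /geq /= leqnn.
rewrite -[RHS]mulr1 -(rowdet_base d) /rowdet -det_mulmx; congr (\det _).
apply/matrixP => i j; rewrite !mxE nth_rows ?size_nseq // nth_nseq ltn_ord add0n.
rewrite psums_jac (@iter_jac _ _ _ _ (d.+1 + (n + i).+1)); last by lia.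
(* An [l]-fold prefix sum vanishes at [d] for [l > d]; what remains is a product of square matrices,
   the second being that of [rowdet_base]. *)
transitivity ((\sum_(l < d.+1) jacm n i l *: psums l (base d) d) 0 j).
  rewrite big_split_ord /= [X in _ + X]big1 ?addr0 // => l _.
  by rewrite psums_small ?scaler0 //=; lia.
rewrite summxE; apply: eq_bigr => l _.
by rewrite !mxE nth_rows ?size_nseq // nth_nseq ltn_ord.
Qed.

Lemma jacmD a b m l K : (m + a < K)%N ->
  jacm (a + b) m l = \sum_(p < K) jacm a m p * jacm b p l.
Proof. by move=> lt_K; rewrite {1}/jacm iterD; exact: (@iter_jac rat^o _ a m K lt_K). Qed.

(** Climbing from 0 to [m] takes at least [m] steps, and exactly [m] only along superdiagonal
    entries 2. *)
Lemma jacm_row0 i m : (i <= m)%N -> jacm i 0 m = if i == m then 2 ^+ i else 0.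
Proof.
suff jac_above p : (p + i <= m)%N ->
   jacm i p m = if (p + i == m)%N then 2 ^+ i else 0 by exact: (jac_above 0%N).
elim: i p => [|i IH] p le_im; first by rewrite addn0 /jacm /=; case: eqP.
have jac0 q : (q + i < m)%N -> jacm i q m = 0.
  by move=> lt_q; rewrite IH ?(ltnW lt_q) // ltn_eqF.
have jac1 : jacm i p.+1 m = if (p + i.+1 == m)%N then 2 ^+ i else 0.
  by rewrite IH addSnnS.
case: p le_im jac1 => [|p] le_im jac1; rewrite ?jacmS0 ?jacmSS jac1 !jac0; try lia.
  by rewrite add0r exprS; case: eqP; rewrite ?mul0rn // mulr_natl.
by rewrite mul0rn !add0r exprS; case: eqP; rewrite ?mul0rn // mulr_natl.
Qed.

Lemma jacm_col0 j m : (j <= m)%N -> jacm j m 0 = (m == j)%:R.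
Proof.
elim: j m => [//|j IH] [//|m] le_jm; rewrite jacmSS !IH; try lia.
by rewrite eqSS (@gtn_eqF _ m.+1) 1?(@gtn_eqF _ m.+2) ?mul0rn ?addr0 //; lia.
Qed.

Lemma hankel_jacm n k :
  \det (\matrix_(i < k, j < k) jacm (n + i + j) 0 0) =
  2 ^+ 'C(k, 2) * \det (\matrix_(m < k, l < k) jacm n m l).
Proof.
have -> : \matrix_(i < k, j < k) jacm (n + i + j) 0 0 =
  (\matrix_(i < k, m < k) jacm i 0 m) *m ((\matrix_(m < k, l < k) jacm n m l) *m
  (\matrix_(l < k, j < k) jacm j l 0)).
  apply/matrixP => i j; rewrite !mxE [(n + i)%N]addnC -addnA.
  (* Both inner indices can be cut at [k]: [J^i] does not lead from 0 to [k] or beyond, as [i < k],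
     and [J^j(l, 0)] vanishes for [l > j]. *)
  rewrite (@jacmD _ _ _ _ k) ?add0n //; apply: eq_bigr => m _; rewrite !mxE; congr (_ * _).
  rewrite (@jacmD _ _ _ _ (k + (m + n).+1)); last by lia.
  rewrite big_split_ord /= [X in _ + X]big1 ?addr0 => [|l _].
    by apply: eq_bigr => l _; rewrite !mxE.
  by rewrite jacm_col0 /= ?gtn_eqF ?mulr0 //; have := ltn_ord j; lia.
rewrite !det_mulmx; congr (_ * _).
  rewrite det_trig; last first.
    by apply/is_trig_mxP => i j lt_ij; rewrite mxE jacm_row0 1?ltnW // ltn_eqF.
  under eq_bigr => i _ do rewrite mxE jacm_row0 // eqxx.
  by rewrite -bin2_sum big_mkord; elim/big_rec2: _ => // i x y _ ->; rewrite exprD.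
rewrite -[X in _ * X]det_tr [X in _ * X]det_trig.
  by rewrite big1 ?mulr1 // => i _; rewrite !mxE jacm_col0 // eqxx.
by apply/is_trig_mxP => i j lt_ij; rewrite !mxE jacm_col0 1?ltnW // gtn_eqF.
Qed.

(** * Little Schroeder paths *)

Lemma card_tuple_cons (A : finType) l (P : pred (seq A)) :
  #|[set t : l.+1.-tuple A | P t]| = (\sum_a #|[set t : l.-tuple A | P (a :: t)]|)%N.
Proof.
under eq_bigr => a _ do rewrite -sum1_card big_mkcond.
rewrite pair_big /= -sum1_card big_mkcond /=.
rewrite (reindex (fun p : A * l.-tuple A => [tuple of p.1 :: p.2])) /=.
  by apply: eq_bigr => p _; rewrite !inE.
exists (fun t => (thead t, [tuple of behead t])) => [[a t] _ | t _] /=.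
  by congr (_, _); apply: val_inj.
by rewrite -tuple_eta.
Qed.

(** For [c <= N] this counts the ways to finish a path with [N] horizontal and [c] vertical units to
    go. *)
Definition sch : nat -> nat -> rat := prof 0 (fun=> 1).

Lemma sch_jacm N : sch N N = jacm N 0 0.
Proof.
have := @psums_jac _ 0 (fun=> 1 : rat) 0 N.
rewrite [psums 0 _ _]/psums /= addn0 -/(sch N N) => ->.
rewrite (@iter_jac rat^o _ _ _ N.+1) // big_ord_recl big1 ?addr0 => [|l _].
  by rewrite [psums _ _ _]/psums /= [RHS](esym (mulr1 _)).
by rewrite psums_small // scaler0.
Qed.

Lemma sch0 N : sch N 0 = 1.
Proof.
elim: N => //= N IH; rewrite /sch /= /clift min0n.
by rewrite /psum big_ord0 mul0rn addr0.
Qed.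

(** First-step recurrence off the diagonal; on it only the vertical step is legal, which is the
    effect of the cap in [sch_diag]. *)
Lemma schS N c : (c < N)%N -> sch N.+1 c.+1 = sch N.+1 c + sch N c.+1 + sch N c.
Proof.
move=> lt_cN; rewrite /sch /= -/(sch N) addn0 /clift (minn_idPl lt_cN).
rewrite (minn_idPl (ltnW lt_cN)) psumS mulrnDl; ring.
Qed.

Lemma sch_diag N : sch N.+1 N.+1 = sch N.+1 N.
Proof. by rewrite /sch /= /clift addn0 minnn (minn_idPr (leqnSn N)). Qed.

Definition nwords m l x y := #|[set t : l.-tuple 'I_3 | schroeder_ok m x y t]|.

Lemma nwords0 m x y : nwords m 0 x y = ((x == m) && (y == m)).
Proof.
rewrite /nwords -sum1_card big_mkcond (bigD1 [tuple]) //= big1 => [|t].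
  by rewrite inE /=; case: ifP.
by rewrite (tuple0 t) => /negP[].
Qed.

Lemma nwordsS m l x y : (x <= y)%N -> nwords m l.+1 x y =
  ((x < y) * nwords m l x.+1 y + nwords m l x y.+1 + (x < y) * nwords m l x.+1 y.+1)%N.
Proof.
move=> le_xy; rewrite /nwords (card_tuple_cons l (schroeder_ok m x y)).
rewrite !big_ord_recl big_ord0 addn0 addnA.
congr (_ + _ + _)%N; rewrite /= ?ltnS ?leqW ?le_xy //=.
  by case: ltnP => _; rewrite ?mul1n // mul0n; apply: eq_card0 => t; rewrite inE.
rewrite ltn_neqAle le_xy andbT.
by case: eqP => _; rewrite ?mul1n // mul0n; apply: eq_card0 => t; rewrite inE.
Qed.

Lemma nwords_out m l x y : (x <= y)%N -> (m < y)%N -> nwords m l x y = 0%N.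
Proof.
elim: l x y => [|l IH] x y le_xy lt_my; first by rewrite nwords0 [y == m]gtn_eqF ?andbF.
rewrite nwordsS // (IH x) ?(IH x.+1 y.+1) ?muln0 ?addn0 //; try lia.
by case: ltnP => // lt_xy; rewrite IH.
Qed.

(** No completion has more than [(m - x) + (m - y)] steps, so all lengths are covered. *)
Lemma sum_nwords m L x y : (x <= y <= m)%N -> ((m - x) + (m - y) < L)%N ->
  (\sum_(l < L) nwords m l x y)%N%:R = sch (m - x) (m - y).
Proof.
elim: L x y => [//|L IH] x y /andP[le_xy le_ym] lt_L.
rewrite big_ord_recl nwords0.
under eq_bigr => l _ do rewrite lift0 nwordsS //.
rewrite !big_split /= -!big_distrr /=.
have out x' y' : (x' <= y')%N -> (m < y')%N -> (\sum_(l < L) nwords m l x' y' = 0)%N.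
  by move=> le' lt'; rewrite big1 // => l _; rewrite nwords_out.
(* On the line [y = m] only horizontal steps survive, so there is a single completion. *)
have [lt_ym|] := ltnP y m; last first.
  move=> le_my; have {le_ym le_my} eq_ym : y = m by lia.
  rewrite {}eq_ym in le_xy lt_L *; rewrite eqxx andbT subnn sch0.
  rewrite (out x m.+1) 1?(out x.+1 m.+1) ?muln0 ?addn0; try lia.
  have [lt_xm|] := ltnP x m; last by rewrite leq_eqVlt => /orP[/eqP->|]; [rewrite eqxx|lia].
  by rewrite ltn_eqF // mul1n IH ?subnn ?sch0 //; lia.
rewrite (ltn_eqF lt_ym) andbF add0n !natrD !natrM.
have [d def_x] : exists d, (m - x = d.+1)%N by exists (m - x).-1; lia.
have [c def_y] : exists c, (m - y = c.+1)%N by exists (m - y).-1; lia.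
rewrite def_x def_y.
have [lt_xy|] := ltnP x y; last first.
  move=> le_yx; have eq_dc : c = d by lia.
  rewrite !mul0r add0r addr0 IH; try lia.
  by rewrite def_x -eq_dc sch_diag (_ : (m - y.+1 = c)%N) //; lia.
rewrite !mul1r !IH; try lia.
rewrite (_ : (m - x.+1 = d)%N); last by lia.
rewrite (_ : (m - y.+1 = c)%N); last by lia.
by rewrite def_x def_y schS; [ring|lia].
Qed.

Lemma little_schroeder_jacm m : (little_schroeder m)%:R = jacm m 0 0.
Proof. by rewrite [LHS](@sum_nwords m _ 0 0) ?subn0 ?sch_jacm //; lia. Qed.

(** * Summation over arrays row by row *)

(** Reads the left neighbour in a row or the row above in an array, with [x] beyond the border; for
    [i <= n] the [oapp] default is never reached. *)
Definition before (A : Type) (x : A) n (f : {ffun 'I_n -> A}) i : A :=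
  if i is j.+1 then oapp f x (insub j) else x.

Lemma beforeS (A : Type) (x : A) n (f : {ffun 'I_n -> A}) (i : 'I_n) :
  before x f i.+1 = f i.
Proof. by rewrite /before /= valK. Qed.

Definition ffcons (A : Type) n (a : A) (f : {ffun 'I_n -> A}) : {ffun 'I_n.+1 -> A} :=
  [ffun i => oapp f a (unlift ord0 i)].

Lemma before_ffcons (A : Type) (x a : A) n (f : {ffun 'I_n -> A}) (i : 'I_n) :
  before x (ffcons a f) i.+1 = before a f i.
Proof.
rewrite -[i.+1]/((widen_ord (leqnSn n) i).+1) beforeS ffunE.
case: unliftP => [j eq_i|eq_i] /=; last by move: (congr1 val eq_i) => /= ->.
by move: (congr1 val eq_i) => /= ->; rewrite beforeS.
Qed.

(** Transfer-matrix form of a sum whose weights link consecutive entries only. *)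
Fixpoint chain (A : finType) (w : nat -> A -> A -> rat) n a x : rat :=
  if n is n'.+1 then \sum_p w a x p * chain w n' a.+1 p else 1.

Lemma sum_ffun_chain (A : finType) (w : nat -> A -> A -> rat) n a x :
  \sum_(P : {ffun 'I_n -> A}) \prod_(i < n) w (a + i)%N (before x P i) (P i) =
  chain w n a x.
Proof.
elim: n a x => [|n IH] a x /=.
  under eq_bigr => P _ do rewrite big_ord0.
  by rewrite sumr_const card_ffun !card_ord expn0.
under [RHS]eq_bigr => p _ do rewrite -IH big_distrr /=.
rewrite pair_big /= (reindex (fun pP : A * {ffun 'I_n -> A} => ffcons pP.1 pP.2)).
  apply: eq_bigr => -[p P] _; rewrite big_ord_recl addn0 ffunE unlift_none.
  congr (_ * _); apply: eq_bigr => i _; rewrite lift0 addSnnS ffunE liftK.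
  by rewrite before_ffcons.
exists (fun P : {ffun 'I_n.+1 -> A} => (P ord0, [ffun i : 'I_n => P (lift ord0 i)])) => [[p P] _ | P _] /=.
  rewrite ffunE unlift_none; congr (_, _); apply/ffunP => i.
  by rewrite !ffunE liftK.
by apply/ffunP => i; rewrite ffunE; case: unliftP => [j ->|->]; rewrite //= ffunE.
Qed.

(** * Conjugation between rows and cutoffs *)

Lemma ltn_sum_initial n (q : pred nat) i :
  (forall i j, (i <= j)%N -> q j -> q i) -> (i < n)%N ->
  (i < \sum_(j < n) q j)%N = q i.
Proof.
move=> down; elim: n => [//|n IH] lt_in; rewrite big_ord_recr /=.
have [qn|nqn] := boolP (q n).
  rewrite (eq_bigr (fun=> 1%N)) => [|j _]; last by rewrite (down j n) // ltnW.
  by rewrite sum1_card card_ord addn1 lt_in (down i n).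
rewrite addn0; case: (ltnP i n) => [/IH //|le_ni].
have -> : i = n by lia.
rewrite (negPf nqn); apply/negbTE; rewrite -leqNgt.
by rewrite -[X in (_ <= X)%N]card_ord -sum1_card leq_sum // => j _; case: (q j).
Qed.

Lemma sum_threshold k p : (p <= k)%N -> (\sum_(s < k) (k <= p + s) = p)%N.
Proof.
elim: k p => [|k IH] p le_p; first by rewrite big_ord0; lia.
rewrite big_ord_recl; under eq_bigr => s _ do rewrite lift0 addnS ltnS.
rewrite /= addn0.
move: le_p; rewrite leq_eqVlt ltnS => /orP[/eqP->|le_p].
  rewrite leqnn (eq_bigr (fun=> 1%N)) => [|s _]; last by rewrite leqW ?leq_addr.
  by rewrite sum1_card card_ord.
by rewrite IH // ltnNge le_p.
Qed.

(** The indices counted are [k - p <= s < k - l]. This turns the exponent of a cell into a count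
    over the [k] paths. *)
Lemma sum_between k l p : (l <= p)%N -> (p <= k)%N ->
  (\sum_(s < k) ((k <= p + s) && (l + s < k)) = p - l)%N.
Proof.
move=> le_lp le_pk; rewrite -{2}(sum_threshold le_pk).
rewrite -{2}(sum_threshold (leq_trans le_lp le_pk)); apply/esym/eqP.
rewrite -(eqn_add2r (\sum_(s < k) (k <= l + s))%N) subnK; last first.
  by apply: leq_sum => s _; case: (leqP k (l + s)) => // le_k;
    rewrite (leq_trans le_k) ?leq_add2r.
rewrite -big_split; apply/eqP; apply: eq_bigr => s _ /=.
case: (leqP k (l + s)) => le_k; rewrite ?andbF ?andbT ?addn0 //.
by rewrite (leq_trans le_k) ?leq_add2r.
Qed.

(** The nested lower limits become one monotonicity condition on a tuple, ready for reindexing by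
    conjugate rows. *)
Lemma nsum_tuple n xs F : all (fun x => x <= n)%N xs ->
  nsum xs F = \sum_(y : (size xs).-tuple 'I_n.+1 |
      sorted geq (map val y) && all2 leq (map val y) xs)
    (\prod_(z <- zip xs (map val y)) corner (z.1 - z.2)) * F (map val y).
Proof.
elim: xs F => [|x xs IH] F /=.
  rewrite (big_pred1 [tuple]) => [|y]; last by rewrite (tuple0 y) /= eqxx.
  by rewrite big_nil mul1r.
case/andP=> le_xn le_xsn; rewrite /nsum -/nsum IH //.
under [LHS]eq_bigr => y _ do
  rewrite (@big_nat_widen _ _ _ _ _ n.+1) ?ltnS // big_geq_mkord big_distrr /=.
rewrite pair_big_dep /=.
rewrite [RHS](reindex (fun p : (size xs).-tuple 'I_n.+1 * 'I_n.+1 => [tuple of p.2 :: p.1])) /=.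
  apply: eq_big => [[y y0]|[y y0] _] /=; last by rewrite big_cons mulrCA mulrA.
  rewrite ltnS; set ys := map val y; have -> : path geq y0 ys = (head 0 ys <= y0)%N && sorted geq ys.
    by case: ys.
  by rewrite -!andbA; do 2!bool_congr; rewrite andbC.
exists (fun t : (size xs).+1.-tuple 'I_n.+1 => ([tuple of behead t], thead t)) => [[t a] _ | t _] /=.
  by congr (_, _); apply: val_inj.
by rewrite -tuple_eta.
Qed.

Lemma ltn_sum_initial_ord n (q : pred 'I_n) (i : 'I_n) :
  (forall i j : 'I_n, (i <= j)%N -> q j -> q i) -> (i < \sum_(j < n) q j)%N = q i.
Proof.
move=> down; pose q' (j : nat) := oapp q false (insub j).
have q'E (j : 'I_n) : q' j = q j by rewrite /q' valK.
under eq_bigr => j _ do rewrite -q'E.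
rewrite ltn_sum_initial // => a b le_ab; rewrite /q'.
case: insubP => //= j _ def_b; case: insubP => [a' _ def_a|]; last first.
  by rewrite -leqNgt => /leq_trans/(_ le_ab); rewrite -def_b leqNgt ltn_ord.
by apply: down; rewrite def_a def_b.
Qed.

Lemma nsum_tnth n k (xs : k.-tuple nat) F : (forall s, tnth xs s <= n)%N ->
  nsum xs F = \sum_(y : k.-tuple 'I_n.+1 |
      sorted geq (map val y) && [forall s, tnth y s <= tnth xs s]%N)
    (\prod_(s < k) corner (tnth xs s - tnth y s)) * F (map val y).
Proof.
move=> le_xs; have {le_xs} : all (fun x => x <= n)%N xs.
  by apply/allP => _ /tnthP[s ->].
have all2E (y : k.-tuple 'I_n.+1) :
    [forall s, tnth y s <= tnth xs s]%N = all2 leq (map val y) xs.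
  rewrite all2E size_map !size_tuple eqxx /=.
  apply/forallP/(all_nthP (0%N, 0%N)) => [le_s i|le_s s].
    rewrite size_zip size_map !size_tuple minnn => lt_i.
    rewrite nth_zip ?size_map ?size_tuple //= (nth_map ord0) ?size_tuple //.
    by have := le_s (Ordinal lt_i); rewrite !(tnth_nth 0%N) (tnth_nth ord0).
  have := le_s s; rewrite size_zip size_map !size_tuple minnn => /(_ (ltn_ord s)).
  rewrite nth_zip ?size_map ?size_tuple //= (nth_map ord0) ?size_tuple //.
  by rewrite !(tnth_nth 0%N) (tnth_nth ord0).
have prodE (y : k.-tuple 'I_n.+1) : \prod_(s < k) corner (tnth xs s - tnth y s) =
    \prod_(z <- zip xs (map val y)) corner (z.1 - z.2).
  rewrite (big_nth (0%N, 0%N)) big_mkord size_zip size_map !size_tuple minnn.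
  apply: eq_bigr => s _; rewrite nth_zip ?size_map ?size_tuple //=.
  by rewrite (nth_map ord0) ?size_tuple // !(tnth_nth 0%N) (tnth_nth ord0).
under eq_bigl => y do rewrite all2E.
under eq_bigr => y _ do rewrite prodE.
case: xs {all2E prodE} => xs /= /eqP size_xs; subst k; exact: nsum_tuple.
Qed.

Section Rows.
Variables n k : nat.
Implicit Types (x p : {ffun 'I_n -> 'I_k.+1}) (y : k.-tuple 'I_n.+1).

Definition monorow p := [forall b : 'I_n, forall b' : 'I_n, (b <= b')%N ==> (p b <= p b')%N].

Definition cut p (s : nat) : nat := \sum_(b < n) (p b + s < k)%N.

Lemma cut_le p s : (cut p s <= n)%N.
Proof.
by rewrite -[X in (_ <= X)%N]card_ord -sum1_card leq_sum // => b _; exact: leq_b1.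
Qed.

(* The conjugate of a weakly increasing row [p], largest part first. *)
Definition cutoffs p : k.-tuple 'I_n.+1 := [tuple inord (cut p s) | s < k].
Arguments cutoffs : simpl never.

Lemma tnth_cutoffs p s : tnth (cutoffs p) s = cut p s :> nat.
Proof. by rewrite tnth_mktuple inordK // ltnS cut_le. Qed.

Definition rowof y : {ffun 'I_n -> 'I_k.+1} :=
  [ffun b : 'I_n => inord (\sum_(s < k) (tnth y s <= b)%N)].

(** Each side determines the other, so [cutoffs] and [rowof] are inverse without any comparison of
    their sums. *)
Definition conj_rel p y := forall (b : 'I_n) s, (b < tnth y s)%N = (p b + s < k)%N.

Lemma sorted_tnthP y : reflect (forall s s' : 'I_k, (s <= s')%N -> (tnth y s' <= tnth y s)%N)
  (sorted geq (map val y)).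
Proof.
have tnthE (s : 'I_k) : tnth y s = nth 0%N (map val y) s :> nat.
  by rewrite (tnth_nth ord0) (nth_map ord0) ?size_tuple.
apply: (iffP idP) => [sorted_y s s' le_s | le_y].
  have geq_trans : transitive geq by move=> ? ? ?; rewrite /geq /= => ? ?; lia.
  have := sorted_leq_nth geq_trans (fun a : nat => leqnn a : geq a a) 0%N sorted_y.
  by rewrite !tnthE; apply; rewrite // inE size_map size_tuple.
apply/(sortedP 0%N) => i; rewrite size_map size_tuple => lt_i.
by have := le_y (Ordinal (ltnW lt_i)) (Ordinal lt_i) (leqnSn i); rewrite !tnthE.
Qed.

Lemma sorted_cutoffs p : sorted geq (map val (cutoffs p)).
Proof.
apply/sorted_tnthP => s s' le_s; rewrite !tnth_cutoffs; apply: leq_sum => b _.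
by case: (ltnP (p b + s') k) => // lt_k; rewrite (leq_ltn_trans _ lt_k) ?leq_add2l.
Qed.

Lemma conj_cutoffs p : monorow p -> conj_rel p (cutoffs p).
Proof.
move=> mono_p b s; rewrite tnth_cutoffs ltn_sum_initial_ord // => i j le_ij.
by apply: leq_ltn_trans; rewrite leq_add2r; move/forallP/(_ i)/forallP/(_ j): mono_p; rewrite le_ij.
Qed.

Lemma rowofE y b : rowof y b = (\sum_(s < k) (tnth y s <= b))%N :> nat.
Proof.
rewrite ffunE inordK // ltnS.
by rewrite -[X in (_ <= X)%N]card_ord -sum1_card leq_sum // => s _; exact: leq_b1.
Qed.

Lemma conj_rowof y : sorted geq (map val y) -> conj_rel (rowof y) y.
Proof.
move=> /sorted_tnthP sorted_y b s; rewrite rowofE.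
have eqk : k = (\sum_(s < k) (tnth y s <= b)%N + \sum_(s < k) (b < tnth y s)%N)%N.
  rewrite -big_split /= -[LHS]card_ord -sum1_card; apply: eq_bigr => i _.
  by rewrite ltnNge; case: leq.
rewrite [X in _ = (_ < X)%N]eqk ltn_add2l ltn_sum_initial_ord // => i j le_ij lt_b.
exact: leq_trans lt_b (sorted_y _ _ le_ij).
Qed.

Lemma conj_rel_injl p p' y : conj_rel p y -> conj_rel p' y -> p = p'.
Proof.
move=> rel rel'; suff le (q q' : {ffun 'I_n -> 'I_k.+1}) b :
    conj_rel q y -> conj_rel q' y -> (q b <= q' b)%N.
  by apply/ffunP => b; apply: val_inj; apply/eqP; rewrite eqn_leq /= !le.
move=> relq relq'; rewrite leqNgt; apply/negP => lt_q.
(* The index [s = k - q b] separates the rows: [q b + s = k], but [q' b + s < k]. *)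
have := ltn_ord (q b); have lt_s : (k - q b < k)%N by have := ltn_ord (q b); lia.
by have := relq' b (Ordinal lt_s); rewrite relq /=; lia.
Qed.

Lemma conj_rel_injr p y y' : conj_rel p y -> conj_rel p y' -> y = y'.
Proof.
move=> rel rel'; suff le (z z' : k.-tuple 'I_n.+1) s :
    conj_rel p z -> conj_rel p z' -> (tnth z s <= tnth z' s)%N.
  by apply: eq_from_tnth => s; apply: val_inj; apply/eqP; rewrite eqn_leq /= !le.
move=> relz relz'; rewrite leqNgt; apply/negP => lt_z.
have lt_n : (tnth z' s < n)%N by have := ltn_ord (tnth z s); lia.
by have := relz (Ordinal lt_n) s; rewrite -relz' /= lt_z ltnn.
Qed.

Definition lower x p b := maxn (x b) (before ord0 p b).
Definition goodrow N x p :=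
  [forall b : 'I_n, if (b < N)%N then (lower x p b <= p b)%N else p b == k :> nat].
(** [2 ^+ (v - l)] counts the sets with maximum [v] and all entries at least [l]. *)
Definition cellw N b l v : rat :=
  if (b < N)%N then (if (l <= v)%N then 2 ^+ (v - l) else 0) else (v == k)%:R.
Definition roww N x p : rat := \prod_(b < n) cellw N b (lower x p b) (p b).

Lemma goodrow_mono N x p : goodrow N x p -> monorow p.
Proof.
move=> /forallP good; apply/forallP => b; apply/forallP => b'; apply/implyP.
have step (c : 'I_n) : (before ord0 p c <= p c)%N.
  have := good c; case: ifP => _; first by rewrite geq_max => /andP[].
  by move/eqP ->; rewrite -ltnS.
move=> le_b; have [d] : exists d, (b' = b + d :> nat)%N by exists (b' - b)%N; lia.
elim: d b' {le_b} => [|d IH] b' def_b'.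
  by rewrite (_ : b = b') //; apply: val_inj; rewrite /= def_b' addn0.
have lt_n : (b + d < n)%N by have := ltn_ord b'; lia.
apply: leq_trans (step b'); rewrite def_b' addnS.
by rewrite -[(b + d)%N]/(val (Ordinal lt_n)) beforeS IH.
Qed.

(** Dominating the row above means having smaller cutoffs, and the value [k] from column [N] on
    bounds every cutoff by [N]. *)
Lemma goodrow_conj N x p y : (N < n)%N -> monorow x -> conj_rel p y ->
  goodrow N x p = [forall s, tnth y s <= minn N (cut x s)]%N.
Proof.
move=> lt_N mono_x rel.
have relx (b : 'I_n) (s : 'I_k) : (b < cut x s)%N = (x b + s < k)%N.
  by rewrite -tnth_cutoffs conj_cutoffs.
apply/idP/forallP => [good s|le_y].
  rewrite leq_min; apply/andP; split.
    move/forallP/(_ (Ordinal lt_N)): good; rewrite /= ltnn => /eqP eqk.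
    by rewrite leqNgt (rel (Ordinal lt_N)) eqk ltnNge leq_addr.
  rewrite leqNgt; apply/negP => lt_c.
  have lt_n : (cut x s < n)%N by have := ltn_ord (tnth y s); lia.
  have := rel (Ordinal lt_n) s; rewrite /= lt_c => /esym lt_p.
  have := relx (Ordinal lt_n) s; rewrite /= ltnn => /esym/negbT.
  move/forallP/(_ (Ordinal lt_n)): good; case: ifP => _.
    by rewrite geq_max => /andP[]; lia.
  by move/eqP; lia.
have mono_p (b b' : 'I_n) : (b <= b')%N -> (p b <= p b')%N.
  move=> le_b; rewrite leqNgt; apply/negP => lt_p.
  have lt_s : (k - p b < k)%N by have := ltn_ord (p b); lia.
  have := rel b (Ordinal lt_s); have := rel b' (Ordinal lt_s) => /=.
  have := ltn_ord (p b); lia.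
apply/forallP => b; case: ifP => [lt_b|/negbT ge_b].
  rewrite geq_max; apply/andP; split.
    rewrite leqNgt; apply/negP => lt_p.
    have lt_s : (k - x b < k)%N by have := ltn_ord (x b); lia.
    have := rel b (Ordinal lt_s); have := relx b (Ordinal lt_s) => /=.
    have := le_y (Ordinal lt_s); have := ltn_ord (x b); rewrite leq_min /=; lia.
  case: b {lt_b} => [[|b] lt_b] //=; rewrite insubT ?(ltnW lt_b) //= => lt_b'.
  exact: mono_p.
rewrite eqn_leq -ltnS ltn_ord /= leqNgt; apply/negP => lt_p.
have lt0k : (0 < k)%N by lia.
have := rel b (Ordinal lt0k); have := le_y (Ordinal lt0k); rewrite leq_min /=; lia.
Qed.

Lemma roww_conj N x p y : (N < n)%N -> monorow x -> goodrow N x p -> conj_rel p y ->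
  roww N x p = \prod_(s < k) corner (minn N (cut x s) - tnth y s).
Proof.
move=> lt_N mono_x good rel.
have le_y : forall s, (tnth y s <= minn N (cut x s))%N.
  by apply/forallP; rewrite -(goodrow_conj lt_N mono_x rel).
have relx (b : 'I_n) (s : 'I_k) : (b < cut x s)%N = (x b + s < k)%N.
  by rewrite -tnth_cutoffs conj_cutoffs.
transitivity ((2 : rat) ^+ (\sum_(b < n | (b < N)%N) (p b - lower x p b))).
  rewrite /roww (big_morph _ (exprD (2 : rat)) (expr0 _)) [RHS]big_mkcond.
  apply: eq_bigr => b _; rewrite /cellw; move/forallP/(_ b): good.
  by case: ifP => _; [move=> -> | move=> /eqP ->; rewrite eqxx].
transitivity ((2 : rat) ^+ (\sum_(s < k) (tnth y s < minn N (cut x s)))).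
  congr (_ ^+ _).
  under eq_bigr => b lt_b.
    have le_low : (lower x p b <= p b)%N by move/forallP/(_ b): good; rewrite lt_b.
    rewrite -(@sum_between k _ _ le_low) -1?ltnS //.
    over.
  rewrite exchange_big /=; apply: eq_bigr => s _.
  have lt_y : (tnth y s < n)%N by have := le_y s; rewrite leq_min; lia.
  (* The first condition says [tnth y s <= b]; the second says [b < cut x s] and, through the left
     neighbour, [b <= tnth y s]. Only the column [tnth y s] contributes. *)
  have termE (b : 'I_n) : ((k <= p b + s) && (lower x p b + s < k))%N =
      (b == Ordinal lt_y) && (b < cut x s)%N.
    rewrite leqNgt -(rel b s) relx /lower addn_maxl gtn_max -val_eqE /=.
    have -> : (before ord0 p b + s < k)%N = (b <= tnth y s)%N.
      case: b => [[|b] lt_b]; first by rewrite /= add0n leq0n ltn_ord.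
      rewrite -[b.+1]/((Ordinal (ltnW lt_b)).+1) beforeS.
      by rewrite -(rel (Ordinal (ltnW lt_b)) s).
    by case: (ltngtP b (tnth y s)); rewrite ?andbF ?andbT.
  under eq_bigr => b _ do rewrite termE.
  rewrite big_mkcond (bigD1 (Ordinal lt_y)) //= big1 ?addn0 => [|b /negPf ->].
    by rewrite eqxx leq_min; case: ltnP.
  by case: ifP.
rewrite (big_morph _ (exprD (2 : rat)) (expr0 _)); apply: eq_bigr => s _.
have := le_y s; rewrite leq_eqVlt /corner => /orP[/eqP->|lt_y].
  by rewrite ltnn subnn.
by rewrite lt_y ifF //; lia.
Qed.

Lemma roww_bad N x p : ~~ goodrow N x p -> roww N x p = 0.
Proof.
case/forallPn => b bad; rewrite /roww (bigD1 b) //= /cellw.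
by move: bad; case: ifP => _ /negPf ->; rewrite !mul0r.
Qed.

(** Bad rows have weight zero and good rows are reindexed by their conjugates, so one row of the
    array is one stage of [nests]. *)
Lemma nsum_roww N x F : (N < n)%N -> monorow x ->
  \sum_p roww N x p * F (map val (cutoffs p)) = nsum (map (minn N) (map val (cutoffs x))) F.
Proof.
move=> lt_N mono_x.
rewrite (bigID (goodrow N x)) /= [X in _ + X]big1 ?addr0 => [|p bad]; last first.
  by rewrite roww_bad ?mul0r.
rewrite (reindex_onto rowof cutoffs) /=; last first.
  move=> p good; apply: conj_rel_injl (conj_rowof (sorted_cutoffs p)) _.
  exact: conj_cutoffs (goodrow_mono good).
rewrite (@nsum_tnth n k [tuple of map (minn N) (map val (cutoffs x))]); last first.
  by move=> s; rewrite tnth_map; lia.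
have tnthE s : tnth [tuple of map (minn N) (map val (cutoffs x))] s = minn N (cut x s).
  rewrite (tnth_map (minn N) [tuple of map val (cutoffs x)]) (tnth_map val).
  by congr minn; apply: tnth_cutoffs.
apply: eq_big => [y|y /andP[good /eqP eq_y]].
  apply/andP/andP => [[good /eqP eq_y]|[sorted_y le_y]].
    have rel := conj_cutoffs (goodrow_mono good); rewrite eq_y in rel.
    split; first by rewrite -eq_y sorted_cutoffs.
    rewrite (goodrow_conj lt_N mono_x rel) in good.
    by apply/forallP => s; rewrite tnthE; apply: (forallP good).
  have rel := conj_rowof sorted_y.
  have good : goodrow N x (rowof y).
    rewrite (goodrow_conj lt_N mono_x rel); apply/forallP => s.
    by rewrite -tnthE; apply: (forallP le_y).
  split => //; apply/eqP; apply: conj_rel_injr rel.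
  exact: conj_cutoffs (goodrow_mono good).
have rel := conj_cutoffs (goodrow_mono good); rewrite eq_y in rel.
rewrite (roww_conj lt_N mono_x good rel); congr (_ * F _); last by rewrite -[in RHS]eq_y.
by apply: eq_bigr => s _; rewrite tnthE.
Qed.

End Rows.

Lemma before_cases (A : Type) (x : A) n (f : {ffun 'I_n -> A}) (i : 'I_n) :
  (i = 0%N :> nat /\ before x f i = x) \/
  (exists2 j : 'I_n, i = j.+1 :> nat & before x f i = f j).
Proof.
case: i => [[|i] lt_i]; first by left.
right; exists (Ordinal (ltnW lt_i)) => //.
by rewrite -[X in before _ _ X]/((Ordinal (ltnW lt_i)).+1) beforeS.
Qed.

(** * Counting valid fillings *)

Section CountFillings.
Variables n k : nat.
Notation filling := (filling n k).
Implicit Types (T : filling) (P : {ffun 'I_n -> {ffun 'I_n -> 'I_k.+1}}).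

Definition maxset (X : {set 'I_k.+1}) : 'I_k.+1 := inord (\max_(r in X) r).

Lemma maxset_mem (X : {set 'I_k.+1}) : X != set0 -> maxset X \in X.
Proof.
move=> /set0Pn[x0 Xx0]; have [|r Xr def_r] := @eq_bigmax_cond _ (mem X) (fun r => val r).
  by apply/card_gt0P; exists x0.
by rewrite /maxset def_r inord_val.
Qed.

Lemma maxset_ge (X : {set 'I_k.+1}) r : r \in X -> (r <= maxset X)%N.
Proof.
move=> Xr; rewrite /maxset inordK; first exact: (@leq_bigmax_cond _ (mem X) (fun r => val r) r Xr).
by rewrite ltnS; apply/bigmax_leqP => i _; rewrite -ltnS.
Qed.

Definition row0 : {ffun 'I_n -> 'I_k.+1} := [ffun=> ord0].

(** With all maxima fixed, the condition concerns a single cell, so the sum over fillings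
    factors. *)
Definition allowed N b l (v : 'I_k.+1) (X : {set 'I_k.+1}) : bool :=
  if (b < N)%N then (v \in X) && [forall r in X, l <= r <= v]%N
  else (X == [set ord_max]) && (v == k :> nat).

Definition cell_allowed T P (a b : 'I_n) :=
  allowed (n - a.+1) b (lower (before row0 P a) (P a) b) (P a b) (T a b).

Definition tops T : {ffun 'I_n -> {ffun 'I_n -> 'I_k.+1}} :=
  [ffun a => [ffun b => maxset (T a b)]].

Lemma valid_allowed T : valid T -> forall a b, cell_allowed T (tops T) a b.
Proof.
case/validP => ne out le a b; rewrite /cell_allowed /allowed !ffunE.
case: ifP => [lt_b|/negbT ge_b]; last first.
  have -> : T a b = [set ord_max] by apply: out; lia.
  rewrite eqxx /=; have /set1P -> // : maxset [set ord_max] \in [set ord_max : 'I_k.+1].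
  by apply: maxset_mem; rewrite -card_gt0 cards1.
rewrite maxset_mem //=; apply/forall_inP => r Tr; rewrite maxset_ge // andbT.
rewrite geq_max; apply/andP; split.
  case: (before_cases row0 (tops T) a) => [[_ ->]|[a' def_a ->]]; rewrite !ffunE //.
  by apply: le Tr; last exact: maxset_mem; rewrite /precedes; lia.
case: (before_cases ord0 (tops T a) b) => [[_ ]|[b' def_b]]; rewrite !ffunE => -> //.
apply: le Tr; last exact: maxset_mem.
by rewrite /precedes; lia.
Qed.

(** Bounds by the north and west maxima suffice: they make [P] monotone along rows and columns and
    so propagate to all preceding cells. *)
Lemma allowed_valid T P : (forall a b, cell_allowed T P a b) -> valid T /\ P = tops T.
Proof.
move=> allow.
have top_mem a b : P a b \in T a b.
  have := allow a b; rewrite /cell_allowed /allowed; case: ifP => _ /andP[] // /eqP-> /eqP eqk.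
  by rewrite inE; apply/eqP/val_inj.
have top_ge a b r : r \in T a b -> (r <= P a b)%N.
  have := allow a b; rewrite /cell_allowed /allowed; case: ifP => _ /andP[].
    by move=> _ /forall_inP le_r /le_r /andP[].
  by move=> /eqP -> /eqP -> _; rewrite -ltnS.
have out (a b : 'I_n) : (n <= (a + b).+1)%N -> T a b = [set ord_max].
  by move=> le_n; have := allow a b; rewrite /cell_allowed /allowed ifF; [by case/andP => /eqP | lia].
have low_le (a b : 'I_n) r : r \in T a b -> (lower (before row0 P a) (P a) b <= r)%N \/ r = ord_max.
  have := allow a b; rewrite /cell_allowed /allowed; case: ifP => _ /andP[].
    by move=> _ /forall_inP le_r /le_r /andP[]; left.
  by move=> /eqP -> _ /set1P ->; right.
have low_top (a b : 'I_n) : (lower (before row0 P a) (P a) b <= P a b)%N.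
  case: (low_le _ _ _ (top_mem a b)) => // ->; rewrite /lower geq_max.
  by rewrite !leq_ord.
have mono1 (a b b' : 'I_n) : (b <= b')%N -> (P a b <= P a b')%N.
  suff : monorow (P a) by move/forallP/(_ b)/forallP/(_ b')/implyP; apply.
  apply: (@goodrow_mono _ _ n (before row0 P a)); apply/forallP => c.
  by rewrite ltn_ord.
have mono2 (a a' b : 'I_n) : (a <= a')%N -> (P a b <= P a' b)%N.
  move=> le_a; have [d] : exists d, (a' = a + d :> nat)%N by exists (a' - a)%N; lia.
  elim: d a' {le_a} => [|d IH] a' def_a'.
    by rewrite (_ : a = a') //; apply: val_inj; rewrite /= def_a' addn0.
  have := low_top a' b; rewrite geq_max => /andP[+ _].
  case: (before_cases row0 P a') => [[]|[c def_c ->]]; first by lia.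
  by apply: leq_trans; apply: IH; lia.
split.
  apply/validP; split => // [a b|a b a' b' r r' prec r_ab r_ab'].
    by apply/set0Pn; exists (P a b).
  case: (low_le _ _ _ r_ab') => [|->]; last by rewrite -ltnS.
  apply: leq_trans; apply: leq_trans (top_ge _ _ _ r_ab) _; rewrite leq_max; apply/orP.
  have [lt_a|le_a] := ltnP a a'.
    left; case: (before_cases row0 P a') => [[]|[c def_c ->]]; first by lia.
    apply: leq_trans (mono1 a b b' _) (mono2 a c b' _); last by lia.
    by case/and3P: prec.
  have eq_a : a = a' by apply: val_inj => /=; case/and3P: prec; lia.
  right; case: (before_cases ord0 (P a') b') => [[]|[c def_c ->]].
    by move: prec; rewrite /precedes eq_a; lia.
  by rewrite eq_a; apply: mono1; move: prec; rewrite /precedes eq_a; lia.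
apply/ffunP => a; apply/ffunP => b; rewrite !ffunE; apply: val_inj; apply/eqP.
rewrite eqn_leq maxset_ge //=; apply: top_ge; apply: maxset_mem.
by apply/set0Pn; exists (P a b).
Qed.

Lemma card_between (l : nat) (v : 'I_k.+1) : (l <= v)%N ->
  #|[set X : {set 'I_k.+1} | (v \in X) && [forall r in X, l <= r <= v]%N]| = (2 ^ (v - l))%N.
Proof.
move=> le_lv; pose I := [set r : 'I_k.+1 | (l <= r < v)%N].
have card_I : #|I| = (v - l)%N.
  rewrite -sum1_card -[RHS]muln1 -sum_nat_const_nat (@big_nat_widen _ _ _ _ _ k.+1) ?(ltnW (ltn_ord v)) //.
  by rewrite big_geq_mkord; apply: eq_bigl => r; rewrite inE andbC.
rewrite -card_I -card_powerset -(@card_in_imset _ _ (fun X => v |: X) (mem (powerset I))).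
  apply: eq_card => X; apply/idP/imsetP => [|[Y]].
    rewrite inE => /andP[Xv /forall_inP le_X]; exists (X :\ v); last by rewrite setD1K.
    rewrite inE; apply/subsetP => r /setD1P[ne_r /le_X /andP[le_r]].
    by rewrite inE le_r /= ltn_neqAle val_eqE ne_r.
  rewrite !inE => /subsetP sub_Y ->; rewrite setU11; apply/forall_inP => r /setU1P[->|/sub_Y].
    by rewrite le_lv leqnn.
  by rewrite inE => /andP[-> /ltnW].
move=> Y Y'; rewrite !inE => sub_Y sub_Y' /(congr1 (fun X => X :\ v)).
by rewrite !setU1K //; apply/negP; [move/(subsetP sub_Y') | move/(subsetP sub_Y)];
  rewrite inE ltnn andbF.
Qed.

Lemma sum_allowed N b (l : nat) (v : 'I_k.+1) :
  \sum_X (allowed N b l v X)%:R = cellw k N b l v.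
Proof.
rewrite /cellw /allowed; case: ifP => _.
  case: ifP => [le_lv|/negbT gt_lv].
    rewrite -natr_sum -natrX -card_between // -sum1_card [X in _ = X%:R]big_mkcond.
    by congr _%:R; apply: eq_bigr => X _; rewrite inE; case: ifP.
  rewrite big1 // => X _; rewrite (_ : (v \in X) && _ = false) //.
  apply/negP => /andP[Xv /forall_inP/(_ v Xv)].
  by rewrite leqnn andbT (negPf gt_lv).
rewrite (bigD1 [set ord_max]) //= eqxx big1 ?addr0 // => X /negPf ->.
by [].
Qed.

Lemma card_valid : (#|[set T : filling | valid T]|%:R : rat) =
  chain (fun a => @roww n k (n - a.+1)) n 0 row0.
Proof.
rewrite -sum_ffun_chain -sum1_card natr_sum big_mkcond /=.
(* For valid [T] only [P = tops T] contributes; otherwise no [P] does. *)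
transitivity (\sum_T \sum_P \prod_(a < n) \prod_(b < n) (cell_allowed T P a b)%:R : rat).
  apply: eq_bigr => T _; rewrite inE.
  have prod0 P : ~~ (valid T && (P == tops T)) ->
      \prod_(a < n) \prod_(b < n) (cell_allowed T P a b)%:R = 0 :> rat.
    move=> bad; apply/eqP/prodf_eq0.
    have [/'forall_forallP/allowed_valid[val_T eq_P]|] :=
        boolP [forall a, forall b, cell_allowed T P a b].
      by rewrite val_T eq_P eqxx in bad.
    case/forallPn => a /forallPn[b not_ab]; exists a => //; apply/prodf_eq0.
    by exists b; rewrite ?(negPf not_ab).
  case: ifP prod0 => [val_T|_] prod0; last by rewrite big1.
  rewrite (bigD1 (tops T)) //= [X in _ + X]big1 ?addr0 => [|P ne_P]; last exact: prod0.
  by rewrite big1 // => a _; rewrite big1 // => b _; rewrite valid_allowed.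
rewrite exchange_big; apply: eq_bigr => P _.
rewrite -(bigA_distr_bigA (fun (a : 'I_n) (t : {ffun 'I_n -> {set 'I_k.+1}}) =>
  \prod_(b < n)
    (allowed (n - a.+1) b (lower (before row0 P a) (P a) b) (P a b) (t b))%:R)).
apply: eq_bigr => a _.
rewrite -(bigA_distr_bigA (fun (b : 'I_n) X =>
  (allowed (n - a.+1) b (lower (before row0 P a) (P a) b) (P a b) X)%:R : rat)).
by apply: eq_bigr => b _; rewrite sum_allowed.
Qed.

Lemma chain_nests m a x : (a + m = n)%N -> monorow x ->
  chain (fun a => @roww n k (n - a.+1)) m a x = nests m (map val (cutoffs x)).
Proof.
elim: m a x => [//|m IH] a x eq_n mono_x; rewrite [LHS]/= [RHS]/=.
rewrite (_ : (n - a.+1 = m)%N); last by lia.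
rewrite -nsum_roww //; last by lia.
apply: eq_bigr => p _; have [good|bad] := boolP (goodrow m x p).
  by rewrite IH ?(goodrow_mono good) //; lia.
by rewrite roww_bad // !mul0r.
Qed.

(** The zero row placed above the array has all [k] cutoffs equal to [n]. *)
Lemma card_valid_nests : (#|[set T : filling | valid T]|%:R : rat) = nests n (nseq k n).
Proof.
rewrite card_valid chain_nests //; last first.
  by apply/forallP => b; apply/forallP => b'; rewrite !ffunE implybT.
congr nests; apply: (@eq_from_nth _ 0%N) => [|i].
  by rewrite size_map size_tuple size_nseq.
rewrite size_map size_tuple => lt_i; rewrite nth_nseq lt_i (nth_map ord0) ?size_tuple //.
rewrite -(tnth_nth _ _ (Ordinal lt_i)) [LHS]tnth_cutoffs /cut.
under eq_bigr => b _ do rewrite ffunE add0n lt_i.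
by rewrite sum1_card card_ord.
Qed.

End CountFillings.

(** * The Hankel formula and its first two cases *)

Lemma nGED_hankel n k : (0 < n)%N -> (0 < k)%N ->
  (nGED (n + 2 * k) n)%:R = (2%:R : rat) ^- 'C(k, 2) *
    \det (\matrix_(i < k, j < k) ((little_schroeder (n + i + j))%:R : rat)).
Proof.
case: k => // d n_gt0 _; rewrite nGED_valid // card_valid_nests nests_jacm.
under [X in _ = _ * \det X]eq_mx => i j do rewrite little_schroeder_jacm.
by rewrite hankel_jacm mulKf // expf_neq0.
Qed.

Theorem theorem5p9 :
  forall n : nat, (1 <= n)%N ->
    [/\ nGED (n + 2) n = little_schroeder n,
        (nGED (n + 4) n)%:R =
          (2%:R : rat)^-1 *
          ((little_schroeder n * little_schroeder (n + 2))%:R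
           - (little_schroeder (n + 1) ^ 2)%:R)
      & forall k : nat, (1 <= k)%N ->
          (nGED (n + 2 * k) n)%:R =
            (2%:R : rat) ^- 'C(k, 2) *
            \det (\matrix_(i < k, j < k)
                    ((little_schroeder (n + i + j))%:R : rat))].
Proof.
move=> n n_gt0; split=> [||k]; last exact: nGED_hankel.
  apply/eqP; rewrite -(eqr_nat rat) -[2%N]muln1 nGED_hankel //.
  by rewrite bin_small // expr0 invr1 mul1r det_mx11 mxE /= !addn0.
rewrite -[4%N]/(2 * 2)%N nGED_hankel // binn expr1; congr (_ * _).
rewrite (expand_det_row _ ord0) !big_ord_recl big_ord0 /cofactor !det_mx11 !mxE /=.
rewrite /bump /= !addn0 !addn1 addnS addn1 expr0 expr1 natrM natrX; ring.
Qed.
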